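(* The exceptional Cayley permutations are exactly the simple parallel alternations, i.e. the permutations $$2\,4\,6\cdots(2m)\,1\,3\,5\cdots(2m-1),\qquad m\geq2,$$ and their symmetries.
   Context: Write $[n]=\{1,\ldots,n\}$. A Cayley permutation of length $n$ is a word $\omega=w_1\cdots w_n$ of positive integers whose set of letters is $[m]$ for some $m\leq n$; equivalently a map $\omega:[n]\to[n]$, $\omega(i)=w_i$, with image $[m]$. $\mathrm{Cay}_n$ is the set of those of length $n$. Every permutation is a Cayley permutation. A nonempty interval of positions $I=[a,b]\subseteq[n]$ is an H-interval of $\omega\in\mathrm{Cay}_n$ if there is an interval of values $J=[c,d]$ with $\omega(I)=J$ and $\omega^{-1}(J)=I$. $\omega\in\mathrm{Cay}_n$ is simple if every H-interval of $\omega$ is a singleton or equals $[n]$. The standardization $\mathrm{st}(w)$ of a word $w$ replaces its smallest letter by $1$, the next smallest by $2$, and so on, keeping repetitions equal. For $i\in[n]$, the one-point deletion is $\omega\setminus i=\mathrm{st}(w_1\cdots w_{i-1}w_{i+1}\cdots w_n)$. For $n\geq2$, a simple Cayley permutation $\omega\in\mathrm{Cay}_n$ is exceptional if $\omega\setminus i$ is not simple for each $i\in[n]$. The symmetries of a permutation are the permutations obtained from it by compositions of reversal, complementation and inversion (the usual dihedral group of symmetries of permutation patterns). *)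

(* Defs.v *)
From mathcomp Require Import all_boot.

Set Implicit Arguments.
Unset Strict Implicit.
Unset Printing Implicit Defensive.

(* A word is a [seq nat]. Its letters are positive integers, but positions are
   counted from 0, so that w_i is [nth 0 w i.-1] and [n] is {i | i < size w}. *)

Definition cayley (w : seq nat) : Prop :=
  exists2 m, m <= size w & w =i iota 1 m.

(* The interval of positions I = [a, b] is an H-interval of w. *)
Definition Hinterval (w : seq nat) (a b : nat) : Prop :=
  a <= b < size w /\
  exists c d : nat,
    (* w(I) = [c, d] *)
    (forall x, (exists2 i, a <= i <= b & nth 0 w i = x) <-> c <= x <= d) /\
    (* w^-1([c, d]) = I *)
    (forall i, i < size w -> (c <= nth 0 w i <= d) = (a <= i <= b)).

Definition simple (w : seq nat) : Prop :=
  forall a b, Hinterval w a b -> a = b \/ (a = 0 /\ b.+1 = size w).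

Definition st (w : seq nat) : seq nat :=
  [seq (index x (sort leq (undup w))).+1 | x <- w].

Definition deletion (w : seq nat) (i : nat) : seq nat :=
  st (take i w ++ drop i.+1 w).

Definition exceptional (w : seq nat) : Prop :=
  [/\ 2 <= size w, cayley w, simple w
    & forall i, i < size w -> ~ simple (deletion w i)].

(* Complement and inverse have their usual meaning only on permutations, i.e.
   words in which each of 1, ..., n occurs exactly once. *)
Definition complement (w : seq nat) : seq nat :=
  [seq (size w).+1 - x | x <- w].

Definition inverse (w : seq nat) : seq nat :=
  [seq (index x w).+1 | x <- iota 1 (size w)].

Inductive symmetry_of (p : seq nat) : seq nat -> Prop :=
| sym_id : symmetry_of p p
| sym_rev q : symmetry_of p q -> symmetry_of p (rev q)
| sym_complement q : symmetry_of p q -> symmetry_of p (complement q)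
| sym_inverse q : symmetry_of p q -> symmetry_of p (inverse q).

(* 2 4 6 ... (2m) 1 3 5 ... (2m-1) *)
Definition parallel_alternation (m : nat) : seq nat :=
  [seq i.*2 | i <- iota 1 m] ++ [seq i.*2.-1 | i <- iota 1 m].

(* Main.v *)
Require Import Defs.
From mathcomp Require Import all_boot zify.

(* View the entries of w as points of a 2-structure: an ordered pair of entries is
   coloured by its comparisons in position and in value, and a pair of equal letters
   gets a colour of its own.  Then w is simple iff the 2-structure is prime, i.e. has
   only trivial modules, and deletions of w are induced substructures.
   By Ehrenfeucht and Rozenberg, in a prime 2-structure a set of at least 3 points
   inducing a prime one, with at least 2 points outside, yields such a set with 2 more
   points.  If a letter is repeated, there are prime sets of both
   sizes 3 and 4, hence one of size n - 1, and w is not exceptional.  An exceptional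
   w is thus a permutation; it contains 2413 or 3142, so n is even and some n - 2
   entries are prime.  The two removed entries x, y are adjacent in position or in
   value, say in position.  After deleting y alone, either x is a corner entry, which
   puts y at an end of w, or x has a twin u on the other side of y such that removing
   y and u also leaves a prime set.  So all pairs of consecutive positions arise in
   this way: entries at distance 2 have consecutive values, and the second and the
   last but one entries are extreme, which determines w up to complement. *)

Set Implicit Arguments.
Unset Strict Implicit.
Unset Printing Implicit Defensive.

(** * Prime 2-structures *)

Section TwoStructures.
Variables (T : finType) (C : eqType) (c : T -> T -> C).

Definition module (A M : {set T}) : bool :=
  (M \subset A) && [forall x in A :\: M, forall y in M, forall z in M, c x y == c x z].

Definition prime_set (A : {set T}) : bool :=
  [forall M : {set T}, module A M ==> (#|M| <= 1) || (M == A)].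

Lemma moduleP (A M : {set T}) :
  reflect (M \subset A /\
           forall x y z, x \in A -> x \notin M -> y \in M -> z \in M -> c x y = c x z)
          (module A M).
Proof.
apply: (iffP andP) => -[sMA H]; split=> //.
  move=> x y z xA xM yM zM; move/forall_inP: H => /(_ x); rewrite inE xA xM => /(_ isT).
  by move=> /forall_inP/(_ y yM)/forall_inP/(_ z zM)/eqP.
apply/forall_inP=> x /setDP[xA xM]; apply/forall_inP=> y yM; apply/forall_inP=> z zM.
by apply/eqP/H.
Qed.

Lemma module_restr (A B M : {set T}) : module A M -> B \subset A -> module B (M :&: B).
Proof.
move=> /moduleP[sMA H] sBA; apply/moduleP; split; first exact: subsetIr.
move=> x y z xB; rewrite !inE xB andbT => xM /andP[yM _] /andP[zM _].
by apply: H => //; apply: (subsetP sBA).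
Qed.

Lemma prime_setP (A : {set T}) :
  reflect (forall M, module A M -> #|M| <= 1 \/ M = A) (prime_set A).
Proof.
apply: (iffP forall_inP) => H M /H; first by case/orP=> [|/eqP]; [left|right].
by case=> [->|->] //; rewrite eqxx orbT.
Qed.

Lemma prime_setPn (A : {set T}) :
  reflect (exists M, [/\ module A M, 1 < #|M| & M != A]) (~~ prime_set A).
Proof.
apply: (iffP forall_inPn) => -[M].
  by rewrite unfold_in => HM; rewrite negb_or -ltnNge => /andP[]; exists M; split.
by case=> HM M1 MA; exists M; rewrite ?unfold_in // negb_or -ltnNge M1.
Qed.

Lemma prime_card2 (A : {set T}) : #|A| <= 2 -> prime_set A.
Proof.
move=> A2; apply/prime_setP => M /andP[sMA _].
case: (leqP #|M| 1) => [|M1]; [by left | right].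
by apply/eqP; rewrite eqEcard sMA (leq_trans A2).
Qed.

Lemma module_pairP (A : {set T}) x y : x \in A -> y \in A ->
  reflect (forall z, z \in A -> z != x -> z != y -> c z x = c z y) (module A [set x; y]).
Proof.
move=> xA yA; apply: (iffP (moduleP _ _)) => [[_ H] z zA zx zy|H].
  by apply: H; rewrite ?inE ?eqxx ?orbT ?negb_or ?zx.
split; first by apply/subsetP=> z; rewrite !inE => /orP[]/eqP->.
move=> z u v zA; rewrite !inE negb_or => /andP[zx zy].
by do 2![case/orP=> /eqP->] => //; rewrite H.
Qed.

Lemma module_setD1P (A : {set T}) y :
  reflect (forall u v, u \in A -> v \in A -> u != y -> v != y -> y \in A -> c y u = c y v)
          (module A (A :\ y)).
Proof.
apply: (iffP (moduleP _ _)) => [[_ H] u v uA vA uy vy yA|H].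
  by apply: H; rewrite ?inE ?eqxx ?uy ?vy.
split; first exact: subsetDl.
move=> x u v xA; rewrite !inE xA andbT negbK => /eqP xy /andP[uy uA] /andP[vy vA].
by rewrite xy in xA *; apply: H.
Qed.

(** The 2-structure is reversible, so an equality of colours read from one end of two pairs can be
    read from the other end. *)
Hypothesis rev : forall x y x' y', c x y = c x' y' -> c y x = c y' x'.

(** A nontrivial module of [x |: X] meets [X] in a module of [X], hence in at most one point or in
    all of [X]. *)
Lemma prime_ext (X : {set T}) x : prime_set X -> x \notin X -> ~~ prime_set (x |: X) ->
  module (x |: X) X \/ exists2 u, u \in X & module (x |: X) [set x; u].
Proof.
move=> /prime_setP pX xX /prime_setPn[M [mM M1 MX]].
have [sM _] := andP mM.
have := module_restr mM (subsetUr _ _); move/pX => [I1|IX].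
  right; have xM : x \in M.
    apply: contraTT M1 => xM; rewrite -leqNgt (leq_trans _ I1) // subset_leq_card //.
    apply/subsetP=> z zM; rewrite inE zM; move: (subsetP sM _ zM).
    by rewrite !inE => /orP[/eqP zx|//]; rewrite -zx zM in xM.
  have defM : M = x |: (M :&: X).
    apply/setP=> z; rewrite !inE; have [->//|zx] := eqVneq z x.
    by case zM: (z \in M) => //; move: (subsetP sM _ zM); rewrite !inE (negbTE zx).
  have /cards1P[u defI] : #|M :&: X| == 1.
    by rewrite eqn_leq I1; move: M1; rewrite {1}defM cardsU1 !inE xM (negbTE xX).
  exists u; last by rewrite -defI -defM.
  have: u \in M :&: X by rewrite defI set11.
  by rewrite inE => /andP[].
left; suff E : X = M; first by rewrite {2}E.
have sXM : X \subset M by rewrite -IX subsetIl.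
apply/eqP; rewrite eqEsubset sXM; apply/subsetP=> z zM.
move: (subsetP sM _ zM); rewrite !inE => /orP[/eqP zx|//].
case/negP: MX; rewrite eqEsubset sM; apply/subsetP=> t.
by rewrite !inE => /orP[/eqP->|/(subsetP sXM)//]; rewrite -zx.
Qed.

(** Twins look alike from every other point of [A], so exchanging [x] and [u] is an isomorphism
    between the two deletions. *)
Lemma prime_twin (A : {set T}) x u : x \in A -> u \in A -> x != u ->
  module A [set x; u] -> prime_set (A :\ x) -> prime_set (A :\ u).
Proof.
move=> xA uA xu /(module_pairP xA uA) tw /prime_setP pA; apply/prime_setP => M.
move=> /moduleP[sM H].
have uM : u \notin M by apply/negP => /(subsetP sM); rewrite !inE eqxx.
(* The image of [M] under this exchange. *)
pose M' := if x \in M then u |: (M :\ x) else M.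
have cM : #|M'| = #|M|.
  rewrite /M'; case: ifP => // xM.
  by rewrite cardsU1 !inE (negbTE uM) andbF add1n (cardsD1 x M) xM.
have M'E z : z \in M' = if z == u then x \in M else if z == x then false else z \in M.
  rewrite /M'; case: ifP => xM; rewrite ?inE; do !case: eqP => //= *; subst=> //.
  - by rewrite (negbTE uM).
have key : module (A :\ x) M'.
  apply/moduleP; split.
    apply/subsetP=> z; rewrite M'E !inE; case: eqP => [->|zu].
      by rewrite uA eq_sym xu.
    by case: eqP => // zx /(subsetP sM); rewrite !inE => /andP[].
  have gen z y : z \in A -> z != x -> z != u -> z \notin M ->
      y \in M' -> exists2 y', y' \in M & c z y = c z y'.
    move=> zA zx zu zM; rewrite M'E; case: eqP => [->|yu].
      by move=> xM; exists x => //; rewrite tw.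
    by case: eqP => // yx yM; exists y.
  move=> z y t; rewrite !inE => /andP[zx zA]; rewrite M'E (negbTE zx).
  case: eqP => [->|/eqP zu] zM yM tM; last first.
    have [y' y'M ->] := gen _ _ zA zx zu zM yM.
    have [t' t'M ->] := gen _ _ zA zx zu zM tM.
    by apply: H => //; rewrite !inE zu.
  have gu v : v \in M' -> c u v = c x v /\ v \in M.
    rewrite M'E; case: eqP => [_ xM|vu]; first by rewrite xM in zM.
    case: eqP => // vx vM; split=> //; apply/esym/rev/tw; try exact/eqP.
    by move: (subsetP sM _ vM); rewrite !inE => /andP[].
  have [-> yM'] := gu _ yM; have [-> tM'] := gu _ tM.
  by apply: H => //; rewrite !inE xu.
case: (pA _ key) => [|E]; [by rewrite cM; left | right].
apply/setP=> z; move/setP/(_ z): (E); rewrite M'E !inE.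
have [->|zu] := eqVneq z u; first by rewrite (negbTE uM).
have [->|//] := eqVneq z x; rewrite xA /= => _.
by move/setP/(_ u): E; rewrite M'E !inE eqxx uA eq_sym xu.
Qed.

Lemma prime_nomodule (A M : {set T}) y z : prime_set A -> module A M ->
  y \in M -> z \in M -> y != z -> M = A.
Proof.
move=> /prime_setP pA /pA[|//] M1 yM zM; case/negP.
by move/card_le1_eqP: M1 => /(_ y z yM zM)->.
Qed.

(** * Growing a prime set by two points *)

Section Extension.
Variable X : {set T}.
Hypotheses (pX : prime_set X) (X3 : 2 < #|X|).

(** Together with [twin] and [ext], these are the classes of the Ehrenfeucht-Rozenberg partition of
    the points outside [X], usually written <X>, X(u) and Ext(X). *)
Definition outer (x : T) := (x \notin X) && module (x |: X) X.
Definition twin (u x : T) := (x \notin X) && module (x |: X) [set x; u].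

Lemma outerP x : outer x -> forall u v, u \in X -> v \in X -> c x u = c x v.
Proof.
move=> /andP[xX /moduleP[_ H]] u v uX vX.
by apply: H; rewrite ?inE ?eqxx.
Qed.

Lemma twinP u x : u \in X -> twin u x -> forall z, z \in X -> z != u -> c z x = c z u.
Proof.
move=> uX /andP[xX /module_pairP H] z zX zu; apply: H; rewrite ?inE ?eqxx ?uX ?zX ?orbT //.
by apply: contraNneq xX => <-.
Qed.

Lemma third u v : exists2 z, z \in X & (z != u) && (z != v).
Proof.
have [z] : exists z, z \in X :\ u :\ v.
  apply/card_gt0P; move: X3; rewrite (cardsD1 u) (cardsD1 v).
  by case: (u \in X); case: (v \in _) => //; lia.
by rewrite !inE => /and3P[zv zu zX]; exists z; rewrite ?zu.
Qed.

(** Otherwise [u] and [v] would look alike from the rest of [X], through [x], and form a module of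
    the prime set [X]. *)
Lemma twin_uniq u v x : u \in X -> v \in X -> twin u x -> twin v x -> u = v.
Proof.
move=> uX vX tu tv; apply/eqP; apply: contraT => uv.
have mX : module X [set u; v].
  by apply/module_pairP => // z zX zu zv; rewrite -(twinP uX tu) // (twinP vX tv).
have E := prime_nomodule pX mX (set21 _ _) (set22 _ _) uv.
by move: X3; rewrite -E cards2; case: (u != v).
Qed.

(** The point [u] would inherit from [x] a uniform view of [X :\ u], making that set a nontrivial
    module of [X]. *)
Lemma outer_twin u x : u \in X -> outer x -> twin u x -> False.
Proof.
move=> uX ox tx; have mX : module X (X :\ u).
  apply/module_setD1P => a b aX bX au bu _; apply: rev.
  rewrite -(twinP uX tx) // -(twinP uX tx (z := b)) //.
  exact/rev/(outerP ox).
have [y yX /andP[yu _]] := third u u.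
have [z zX /andP[zu zy]] := third u y.
have E := prime_nomodule (y := y) (z := z) pX mX.
move: uX; rewrite -E ?inE ?eqxx ?yu ?yX ?zu ?zX //; by rewrite eq_sym.
Qed.

Lemma outer_out x : outer x -> x \notin X. Proof. by case/andP. Qed.
Lemma twin_out u x : twin u x -> x \notin X. Proof. by case/andP. Qed.

Definition ext (x : T) := prime_set (x |: X) && (x \notin X).

Lemma ext_outer x : ext x -> outer x -> False.
Proof.
case/andP=> px xX /andP[_ m].
have [y yX /andP[yu _]] := third x x.
have [z zX /andP[zu zy]] := third x y.
have E := prime_nomodule px m yX zX; move: xX; rewrite E ?inE ?eqxx //.
by rewrite eq_sym.
Qed.

Lemma ext_twin u x : u \in X -> ext x -> twin u x -> False.
Proof.
move=> uX /andP[px xX] /andP[_ m].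
have E := prime_nomodule px m (set21 _ _) (set22 _ _).
have [y yX /andP[yu yx]] := third u x.
have : y \in [set x; u] by rewrite E ?inE ?yX ?orbT //; apply: contraNneq xX => ->.
by rewrite !inE (negbTE yu) (negbTE yx).
Qed.

Lemma ext_cases x : x \notin X -> [\/ ext x, outer x | exists2 u, u \in X & twin u x].
Proof.
move=> xX; have [px|npx] := boolP (prime_set (x |: X)).
  by apply: Or31; rewrite /ext px.
have [m|[u uX m]] := prime_ext pX xX npx.
  by apply: Or32; rewrite /outer xX.
by apply: Or33; exists u; rewrite /twin ?xX.
Qed.

Section NoPair.
Hypothesis noP : forall x y, x \notin X -> y \notin X -> x != y ->
  ~~ prime_set (x |: (y |: X)).

(** One case for each shape of a nontrivial module M of [x |: (y |: X)], whose trace on [X] is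
    empty, a point u or all of [X]. In order, M is {x, y}, {u, x}, {u, y}, {u, x, y}, X + y, X + x
    and X. *)
Inductive pair_spec x y : Prop :=
| PairTwins of forall z, z \in X -> c z x = c z y
| PairTwinL u of u \in X & twin u x & c y x = c y u
| PairTwinR u of u \in X & twin u y & c x y = c x u
| PairTwinLR u of u \in X & twin u x & twin u y
| PairOuterL of outer x & forall u, u \in X -> c x y = c x u
| PairOuterR of outer y & forall u, u \in X -> c y x = c y u
| PairOuterLR of outer x & outer y.

Lemma pairP x y : x \notin X -> y \notin X -> x != y -> pair_spec x y.
Proof.
move=> xX yX xy; have /prime_setPn[M [mM M1 MA]] := noP xX yX xy.
have sXA : X \subset x |: (y |: X) by apply/subsetP=> z zX; rewrite !inE zX !orbT.
have xA : x \in x |: (y |: X) by rewrite !inE eqxx.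
have yA : y \in x |: (y |: X) by rewrite !inE eqxx orbT.
have sxA : x |: X \subset x |: (y |: X).
  by apply/subsetP=> z; rewrite !inE => /orP[]->; rewrite ?orbT.
have syA : y |: X \subset x |: (y |: X).
  by apply/subsetP=> z; rewrite !inE => /orP[]->; rewrite ?orbT.
have /moduleP[sM H] := mM.
have sub z : z \in M -> [|| z == x, z == y | z \in X].
  by move/(subsetP sM); rewrite !inE.
have [I1|IX] := prime_setP _ pX _ (module_restr mM sXA).
  have [I0|[u uI]] := set_0Vmem (M :&: X).
    have nX z : z \in M -> z \notin X.
      by move=> zM; apply/negP => zX; move/setP/(_ z): I0; rewrite !inE zM zX.
    have [xM yM] : x \in M /\ y \in M.
      move: M1 => /card_gt1P[a [b [aM bM ab]]].
      move: (sub a aM) (sub b bM) ab; rewrite (negbTE (nX a aM)) (negbTE (nX b bM)) !orbF.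
      by move=> /orP[]/eqP ea /orP[]/eqP eb; subst=> //; rewrite ?eqxx // => _; split.
    by apply: PairTwins => z zX; apply: H => //;
      [exact: (subsetP sXA) | apply: contraL zX; exact: nX].
  have IE : M :&: X = [set u].
    by apply/eqP; rewrite eq_sym eqEcard cards1 I1 andbT sub1set.
  move: uI; rewrite inE => /andP[uM uX].
  have tw z : z \notin X -> z \in M -> z |: X \subset x |: (y |: X) -> twin u z.
    move=> zX zM sA; rewrite /twin zX -(_ : M :&: (z |: X) = [set z; u]) ?(module_restr mM) //.
    by rewrite setIUr IE; congr (_ :|: _); apply/setIidPr; rewrite sub1set.
  have [xM|xM] := boolP (x \in M); have [yM|yM] := boolP (y \in M).
  - by apply: (@PairTwinLR _ _ u) => //; apply: tw.
  - by apply: (@PairTwinL _ _ u) => //; [apply: tw | apply: H].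
  - by apply: (@PairTwinR _ _ u) => //; [apply: tw | apply: H].
  - have sMX : M \subset X.
      apply/subsetP=> z zM; case/or3P: (sub z zM) => // /eqP E; rewrite E in zM.
        by rewrite zM in xM.
      by rewrite zM in yM.
    by move: M1; rewrite -(setIidPl sMX) IE cards1.
have sXM : X \subset M by rewrite -IX subsetIl.
have out z : z \notin X -> z \notin M -> z |: X \subset x |: (y |: X) -> outer z.
  move=> zX zM sA; rewrite /outer zX; have := module_restr mM sA.
  rewrite setIUr IX (_ : M :&: [set z] = set0) ?set0U //.
  by apply/setP=> t; rewrite !inE; case: eqP => [->|]; rewrite ?andbF // (negbTE zM).
have [xM|xM] := boolP (x \in M); have [yM|yM] := boolP (y \in M).
- case/negP: MA; rewrite eqEsubset sM; apply/subsetP=> z; rewrite !inE.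
  by case/or3P=> [/eqP->|/eqP->|/(subsetP sXM)].
- apply: PairOuterR; first exact: out.
  by move=> u uX; apply: H => //; apply: (subsetP sXM).
- apply: PairOuterL; first exact: out.
  by move=> u uX; apply: H => //; apply: (subsetP sXM).
- by apply: PairOuterLR; apply: out.
Qed.

Lemma twins_outer x y : x \notin X -> y \notin X ->
  (forall z, z \in X -> c z x = c z y) -> outer x -> outer y.
Proof.
move=> xX yX tw ox; rewrite /outer yX; apply/moduleP; split; first exact: subsetUr.
move=> z u v; rewrite !inE => /orP[/eqP-> _ uX vX|->//].
by rewrite (rev (esym (tw u uX))) (rev (esym (tw v vX))) (outerP ox uX vX).
Qed.

Lemma twins_twin x y u : u \in X -> x \notin X -> y \notin X ->
  (forall z, z \in X -> c z x = c z y) -> twin u x -> twin u y.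
Proof.
move=> uX xX yX tw tx; rewrite /twin yX; apply/module_pairP; rewrite ?inE ?eqxx ?uX ?orbT //.
move=> z; rewrite !inE => /orP[->//|zX] _ zu.
by rewrite -tw // (twinP uX tx).
Qed.

(** Each shape of [pair_spec] either contradicts the classes of the two points or yields the
    equality. The same holds for [pair_twin] and [pair_ext]. *)
Lemma pair_outer x y u : outer x -> ~~ outer y -> y \notin X -> u \in X -> c x y = c x u.
Proof.
move=> ox oy yX uX; have xX := outer_out ox.
have xy : x != y by apply: contraNneq oy => <-.
case: (pairP xX yX xy) => //.
- by move=> tw; rewrite (twins_outer xX yX tw ox) in oy.
- by move=> v vX /(outer_twin vX ox).
- by move=> v vX _ ->; apply: (outerP ox).
- by move=> v vX /(outer_twin vX ox).
- by move=> _; apply.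
- by move=> oy'; rewrite oy' in oy.
- by move=> _ oy'; rewrite oy' in oy.
Qed.

Lemma pair_twin x y u : u \in X -> twin u x -> ~~ twin u y -> y \notin X -> c y x = c y u.
Proof.
move=> uX tx ty yX; have xX := twin_out tx.
have xy : x != y by apply: contraNneq ty => <-.
case: (pairP xX yX xy) => //.
- by move=> tw; rewrite (twins_twin uX xX yX tw tx) in ty.
- by move=> v vX tvx; rewrite (twin_uniq uX vX tx tvx).
(* Here the chain is [c y x] = [c v x] = [c v u] = [c y u]. *)
- move=> v vX tvy E; have vu : v != u by apply: contraNneq ty => <-.
  rewrite (rev E) (twinP uX tx vX vu); apply/rev/esym/(twinP vX tvy uX).
  by rewrite eq_sym.
- by move=> v vX tvx tvy; rewrite (twin_uniq uX vX tx tvx) tvy in ty.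
- by move=> ox; case: (outer_twin uX ox tx).
- by move=> _; apply.
- by move=> ox; case: (outer_twin uX ox tx).
Qed.

Lemma pair_ext x y z : ext x -> ext y -> z \in X -> c z x = c z y.
Proof.
move=> ex ey zX; have [->//|xy] := eqVneq x y.
have [[_ xX] [_ yX]] := (andP ex, andP ey).
case: (pairP xX yX xy) => //; first exact.
- by move=> v vX /(ext_twin vX ex).
- by move=> v vX /(ext_twin vX ey).
- by move=> v vX /(ext_twin vX ex).
- by move/(ext_outer ex).
- by move/(ext_outer ey).
- by move/(ext_outer ex).
Qed.

Hypothesis pT : prime_set setT.

(* The complement of outer, each u together with twin u, and ext are modules of the
   whole structure, so there are no outer points, no twins and at most one ext point. *)
Lemma no_pair_card : #|~: X| <= 1.
Proof.
have [u0 u0X _] : exists2 z, z \in X & (z != z) || true.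
  by have /card_gt0P[z zX] : 0 < #|X| by [lia]; exists z; rewrite ?orbT.
have noO x : outer x = false.
  apply/negP => ox.
  have m : module setT [set z | ~~ outer z].
    apply/moduleP; split=> [|y z z' _]; first exact: subsetT.
    rewrite !inE negbK => oy.
    have E t : ~~ outer t -> c y t = c y u0.
      move=> ot; have [tX|tX] := boolP (t \in X); first exact: (outerP oy).
      exact: pair_outer.
    by move=> /E-> /E->.
  have [z zX /andP[zu _]] := third u0 u0.
  have inX t : t \in X -> t \in [set z | ~~ outer z].
    by rewrite inE => tX; apply: contraL tX => /outer_out.
  have /setP/(_ x) := prime_nomodule pT m (inX _ zX) (inX _ u0X) zu.
  by rewrite !inE ox.
have noT u x : u \in X -> twin u x = false.
  move=> uX; apply/negP => tx; have xX := twin_out tx.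
  have m : module setT [set z | (z == u) || twin u z].
    apply/moduleP; split=> [|y z z' _]; first exact: subsetT.
    rewrite !inE negb_or => /andP[yu ty].
    have E t : (t == u) || twin u t -> c y t = c y u.
      case/orP=> [/eqP->//|tt]; have [yX|yX] := boolP (y \in X).
        exact: (twinP uX tt).
      exact: pair_twin.
    by move=> /E-> /E->.
  have [z zX /andP[zu _]] := third u u.
  have /setP/(_ z) : [set z | (z == u) || twin u z] = setT.
    apply: (@prime_nomodule setT _ u x); rewrite ?inE ?eqxx ?tx ?orbT //.
    by apply: contraNneq xX => <-.
  by rewrite !inE (negbTE zu) /twin zX.
have allE x : x \notin X -> ext x.
  by case/ext_cases=> //; [rewrite noO | case=> u uX; rewrite noT].
have m : module setT (~: X).
  apply/moduleP; split=> [|y z z' _]; first exact: subsetT.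
  rewrite !inE negbK => yX zX z'X.
  by apply: pair_ext => //; apply: allE.
case: (prime_setP _ pT _ m) => // /setP/(_ u0).
by rewrite !inE u0X.
Qed.

End NoPair.
End Extension.

Theorem prime_extend2 (X : {set T}) : prime_set setT -> prime_set X -> 2 < #|X| ->
  1 < #|~: X| -> exists2 Y : {set T}, prime_set Y & #|Y| = #|X|.+2.
Proof.
move=> pT pX X3 XC.
have [/existsP[x /existsP[y /and4P[xX yX xy p]]]|N] :=
  boolP [exists x, exists y, [&& x \notin X, y \notin X, x != y & prime_set (x |: (y |: X))]].
  by exists (x |: (y |: X)) => //; rewrite !cardsU1 !inE negb_or xy xX yX.
suff : #|~: X| <= 1 by lia.
apply: no_pair_card => // x y xX yX xy; apply: contra N => p.
by apply/existsP; exists x; apply/existsP; exists y; rewrite xX yX xy.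
Qed.

Corollary prime_extend (X : {set T}) k : prime_set setT -> prime_set X -> 2 < #|X| ->
  #|X| + k.*2 <= #|T| -> exists2 Y : {set T}, prime_set Y & #|Y| = #|X| + k.*2.
Proof.
move=> pT pX X3; elim: k => [|k IH] le; first by exists X; rewrite ?addn0.
have [|Y pY cY] := IH; first by lia.
have [||Z pZ cZ] := prime_extend2 pT pY; [lia | have := cardsC Y; lia |].
by exists Z => //; lia.
Qed.

End TwoStructures.

(** * 2-structures with a colour used only once *)

Section UniqueColour.
Variables (T : finType) (C : eqType) (c : T -> T -> C).
Hypothesis rev : forall x y x' y', c x y = c x' y' -> c y x = c y' x'.
Hypothesis pT : prime_set c setT.

(** Growing by two points at a time keeps the parity, so the size [#|T| - 1] is hit exactly. *)
Lemma prime_deletion (X : {set T}) : prime_set c X -> 2 < #|X| -> #|X| < #|T| ->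
  odd #|X| = ~~ odd #|T| -> exists x, prime_set c (setT :\ x).
Proof.
move=> pX X3 XT oX; pose k := (#|T| - #|X|)./2.
have E : #|X| + k.*2 = #|T|.-1.
  have := odd_double_half (#|T| - #|X|); rewrite oddB; last exact: ltnW.
  by rewrite oX addbN addbb /= -/k; clearbody k; lia.
have [|Y pY cY] := prime_extend rev (k := k) pT pX X3; first by lia.
have /eqP/cards1P[x xE] : #|~: Y| = 1 by have := cardsC Y; lia.
by exists x; rewrite -xE setTD setCK.
Qed.

Variables a b : T.
Hypothesis ab : a != b.
(** The model is a pair of positions that carry the same letter. *)
Hypothesis uab : forall x y, c x y = c a b -> x = a /\ y = b.

Lemma uba x y : c x y = c b a -> x = b /\ y = a.
Proof. by move/rev/uab => -[-> ->]. Qed.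

Definition separator x := [&& x != a, x != b & c x a != c x b].

Lemma separator_exists : 2 < #|T| -> exists x, separator x.
Proof.
move=> T3; apply/existsP; apply: contraT => /existsPn N.
have m : module c setT [set a; b].
  apply/module_pairP; rewrite ?inE // => z _ za zb.
  by apply/eqP; apply: contraNT (N z) => zs; rewrite /separator za zb zs.
have := prime_nomodule pT m (set21 _ _) (set22 _ _) ab.
by move/(congr1 (fun A : {set T} => #|A|)); rewrite cards2 ab cardsT; lia.
Qed.

(** If a module contains just one of [a], [b], the other one sees all of it in a colour that occurs
    only once, so it is a single point. If it contains both, [x] tells them apart and must belong to
    it. *)
Lemma prime_triple x : separator x -> prime_set c (x |: [set a; b]).
Proof.
case/and3P=> xa xb xs; apply/prime_setP => M /moduleP[sM H].
have aX : a \in x |: [set a; b] by rewrite !inE eqxx orbT.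
have bX : b \in x |: [set a; b] by rewrite !inE eqxx !orbT.
have xX : x \in x |: [set a; b] by rewrite !inE eqxx.
have [aM|aM] := boolP (a \in M); have [bM|bM] := boolP (b \in M).
- right; apply/eqP; rewrite eqEsubset sM; apply/subsetP=> z; rewrite !inE.
  case/or3P=> /eqP-> //; apply: contraNT xs => xM; exact/eqP/H.
- left; apply/card_le1_eqP => y z yM zM.
  have N t : t \in M -> t = a by move=> tM; have /uba[] := H _ _ _ bX bM tM aM.
  by rewrite (N y) // (N z).
- left; apply/card_le1_eqP => y z yM zM.
  have N t : t \in M -> t = b by move=> tM; have /uab[] := H _ _ _ aX aM tM bM.
  by rewrite (N y) // (N z).
- left; apply/card_le1_eqP => y z yM zM.
  have N t : t \in M -> t = x.
    move=> tM; move: (subsetP sM _ tM); rewrite !inE.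
    by case/or3P=> /eqP E; rewrite -?E ?tM // in aM bM *; rewrite tM in aM bM.
  by rewrite (N y) // (N z).
Qed.

Lemma card_triple x : separator x -> #|x |: [set a; b]| = 3.
Proof. by case/and3P=> xa xb xs; rewrite cardsU1 cards2 !inE ab (negbTE xa) (negbTE xb). Qed.

(** These are the cases of [prime_ext], where [y] can only be a twin of [x]: as a twin of [a] or [b]
    it would repeat the colour of [(b, a)] or [(a, b)]. *)
Lemma prime_quad x y : separator x -> y \notin x |: [set a; b] ->
  prime_set c (y |: (x |: [set a; b])) \/
  (forall u v, u \in x |: [set a; b] -> v \in x |: [set a; b] -> c y u = c y v) \/
  (c a y = c a x /\ c b y = c b x).
Proof.
move=> sx yX; have [|np] := boolP (prime_set c (y |: (x |: [set a; b]))); [by left | right].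
have /and3P[xa xb xs] := sx.
have [ya yb yx] : [/\ y != a, y != b & y != x].
  by move: yX; rewrite !inE !negb_or => /and3P[-> -> ->].
have [m|[u uX m]] := prime_ext (prime_triple sx) yX np.
  by left; move/moduleP: m => [_ H] u v uX vX; apply: H => //; apply: setU11.
right; have uA : u \in y |: (x |: [set a; b]) by rewrite inE uX orbT.
have H := elimT (module_pairP c (setU11 _ _) uA) m.
have Ha : a != y -> a != u -> c a y = c a u by apply: H; rewrite !inE eqxx !orbT.
have Hb : b != y -> b != u -> c b y = c b u by apply: H; rewrite !inE eqxx !orbT.
move: uX; rewrite ?inE => /or3P[]/eqP E; subst u.
- by rewrite Ha ?Hb // eq_sym.
- have /uba[_ E] : c b y = c b a by rewrite Hb // eq_sym.
  by rewrite E eqxx in ya.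
- have /uab[_ E] : c a y = c a b by rewrite Ha // eq_sym.
  by rewrite E eqxx in yb.
Qed.

Lemma prime_quad_exists : 3 < #|T| -> exists X : {set T}, prime_set c X /\ #|X| = 4.
Proof.
move=> T4; pose Z := [set x | separator x].
have [/existsP[X /andP[pX /eqP cX]]|N] :=
  boolP [exists X : {set T}, prime_set c X && (#|X| == 4)]; first by exists X.
have nq x y : separator x -> y \notin x |: [set a; b] ->
   ~~ prime_set c (y |: (x |: [set a; b])).
  move=> sx yX; apply: contra N => p; apply/existsP; exists (y |: (x |: [set a; b])).
  by rewrite p cardsU1 yX card_triple.
have ZE x : (x \in Z) = separator x by rewrite inE.
(* A point y outside this set does not separate [a] from [b], so it is no twin of a separator t.
   Without prime quadruples it must then see t, [a] and [b] alike, which makes the set a module. *)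
have TE : Z :|: [set a; b] = setT.
  apply: (@prime_nomodule _ _ c _ _ a b pT) => //; rewrite ?inE ?eqxx ?orbT //.
  apply/moduleP; split=> [|y u v _]; first exact: subsetT.
  rewrite !in_setU !in_set1 !ZE !negb_or => /andP[ys /andP[ya yb]].
  have yab : c y a = c y b.
    by apply/eqP; apply: contraT => h; rewrite /separator ya yb h in ys.
  have E t : separator t -> c y t = c y a.
    move=> st; have yX : y \notin t |: [set a; b].
      by rewrite !inE !negb_or ya yb !andbT; apply: contraNneq ys => ->.
    case: (prime_quad st yX) => [p|]; first by case/negP: (nq _ _ st yX).
    case=> [|[/rev Ea /rev Eb]]; first by apply; rewrite !inE eqxx ?orbT.
    by case/and3P: st => _ _; rewrite -Ea -Eb yab eqxx.
  have E' t : separator t || ((t == a) || (t == b)) -> c y t = c y a.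
    by case/or3P=> [/E//|/eqP->|/eqP->].
  by move=> /E'-> /E'->.
(* No separator sees [a] and [b] alike, so any two separators are twins over [a] and [b], the only
   points outside [Z]. *)
have mZ : module c setT Z.
  apply/moduleP; split=> [|y u v _]; first exact: subsetT.
  rewrite !ZE => ys su sv; have [->//|uv] := eqVneq u v.
  have vX : v \notin u |: [set a; b].
    by case/and3P: sv => va vb _; rewrite !inE !negb_or va vb !andbT eq_sym.
  have [Ea Eb] : c a v = c a u /\ c b v = c b u.
    case: (prime_quad su vX) => [p|]; first by case/negP: (nq _ _ su vX).
    by case=> // H; case/and3P: sv => _ _ /eqP[]; apply: H; rewrite !inE eqxx ?orbT.
  have : y \in Z :|: [set a; b] by rewrite TE inE.
  by rewrite !inE (negbTE ys) /= => /orP[]/eqP->; rewrite ?Ea ?Eb.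
(* By [TE], [Z] has [#|T| - 2] points, which is at least two; yet it misses [a]. *)
have /card_gt1P[u [v [uZ vZ uv]]] : 1 < #|Z|.
  have := cardsUI Z [set a; b]; rewrite TE cardsT cards2 ab.
  have : #|Z :&: [set a; b]| <= 0; last lia.
  rewrite leqn0 cards_eq0 -subset0; apply/subsetP=> z; rewrite !inE.
  by move/andP=> [/and3P[za zb _]]; rewrite (negbTE za) (negbTE zb).
have /setP/(_ a) := prime_nomodule pT mZ uZ vZ uv.
by rewrite !inE /separator eqxx.
Qed.

Theorem unique_colour_deletion : 3 < #|T| -> exists x, prime_set c (setT :\ x).
Proof.
move=> T4; have [X [pX cX]] := prime_quad_exists T4.
(* The starting set is the quadruple if [#|T|] is odd and a triple if it is even. *)
have [oT|oT] := boolP (odd #|T|).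
  apply: (@prime_deletion X); rewrite ?cX ?oT //.
  by rewrite ltn_neqAle T4 andbT; apply: contraTneq oT => <-.
have [x sx] := separator_exists (ltnW T4).
by apply: (prime_deletion (prime_triple sx)); rewrite card_triple ?oT // ltnW.
Qed.

End UniqueColour.

(** * Points with two coordinates *)

(** Modules depend only on which colours seen from a common point coincide. This gives invariance
    under inversion, complement and standardization. *)
Lemma prime_congr (T : finType) (C C' : eqType) (c : T -> T -> C) (c' : T -> T -> C')
    (A : {set T}) :
  {in A & &, forall x y z, (c x y == c x z) = (c' x y == c' x z)} ->
  prime_set c A = prime_set c' A.
Proof.
move=> E; suff mE M : module c A M = module c' A M by apply: eq_forallb => M; rewrite mE.
apply/moduleP/moduleP => -[sM H]; split=> // x y z xA xM yM zM; apply/eqP.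
  by rewrite -E ?(subsetP sM _ yM) ?(subsetP sM _ zM) //; apply/eqP; apply: H.
by rewrite E ?(subsetP sM _ yM) ?(subsetP sM _ zM) //; apply/eqP; apply: H.
Qed.

(** Each inequality excludes one of the six pairs as a module, and together they also exclude the
    four triples. *)
Lemma prime_four (T : finType) (C : eqType) (c : T -> T -> C) (s u l v : T) :
  c v s != c v u -> c u s != c u l -> c u s != c u v ->
  c s u != c s l -> c l u != c l v -> c s l != c s v ->
  prime_set c [set x in [:: s; u; l; v]].
Proof.
move=> h1 h2 h3 h4 h5 h6; apply/prime_setP => M /moduleP[sM H].
have no x y z : x \in [:: s; u; l; v] -> c x y != c x z ->
    ~~ [&& x \notin M, y \in M & z \in M].
  by move=> xX; apply: contraNN => /and3P[*]; apply/eqP/H; rewrite // inE.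
have [sX uX lX vX] : [/\ s \in [:: s; u; l; v], u \in [:: s; u; l; v],
    l \in [:: s; u; l; v] & v \in [:: s; u; l; v]].
  by split; rewrite !inE eqxx ?orbT.
move: (no _ _ _ vX h1) (no _ _ _ uX h2) (no _ _ _ uX h3).
move: (no _ _ _ sX h4) (no _ _ _ lX h5) (no _ _ _ sX h6) => {sX uX lX vX}.
have sub t : t \in M -> [\/ t = s, t = u, t = l | t = v].
  move/(subsetP sM); rewrite !inE.
  by case/or4P=> /eqP->; [apply: Or41 | apply: Or42 | apply: Or43 | apply: Or44].
have [sM'|sM'] := boolP (s \in M); have [uM|uM] := boolP (u \in M);
have [lM|lM] := boolP (l \in M); have [vM|vM] := boolP (v \in M) => //= *.
  right; apply/eqP; rewrite eqEsubset sM; apply/subsetP=> t; rewrite !inE.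
  by case/or4P=> /eqP->.
all: left; apply/card_le1_eqP => y z yM zM; move: (sub y yM) (sub z zM).
all: by case=> ?; case=> ?; subst y z => //; rewrite ?yM ?zM in sM' uM lM vM.
Qed.

Section Points.
Variable T : finType.
Implicit Types p q : T -> nat.

(* A pair tied in p or q has a colour that no other ordered pair has, so it lies
   in every module with at least two points that contains one of its members. *)
Definition colour p q (x y : T) : (T * T) + (bool * bool) :=
  if (p x == p y) || (q x == q y) then inl (x, y) else inr (p x < p y, q x < q y).

(** Strict on purpose: a point tied with [y] or [z] is on no side, in accordance with the private
    colours of tied pairs. *)
Definition same_side p x y z :=
  (p x < p y) && (p x < p z) || (p y < p x) && (p z < p x).

Lemma colour_rev p q x y x' y' :
  colour p q x y = colour p q x' y' -> colour p q y x = colour p q y' x'.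
Proof.
rewrite /colour !(eq_sym (p y)) !(eq_sym (q y)) !(eq_sym (p y')) !(eq_sym (q y')).
case: ifP => h; case: ifP => h' // -[]; first by move=> -> ->.
by move=> E1 E2; congr (inr (_, _)); move: h h' E1 E2; lia.
Qed.

Lemma colourE p q x y z : y != z ->
  (colour p q x y == colour p q x z) = same_side p x y z && same_side q x y z.
Proof.
move=> yz; rewrite /colour /same_side; apply/eqP/idP.
  case: ifP => h; case: ifP => h' // -[]; first by move=> E; rewrite E eqxx in yz.
  by move: h h'; lia.
move=> h; do 2![rewrite ifN; last by lia].
by congr (inr (_, _)); lia.
Qed.

Lemma prime_colour_swap p q A : prime_set (colour q p) A = prime_set (colour p q) A.
Proof.
apply: prime_congr => x y z _ _ _; have [->|yz] := eqVneq y z; first by rewrite !eqxx.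
by rewrite !colourE // andbC.
Qed.

Lemma prime_colour_opp p q N A : (forall x, q x <= N) ->
  prime_set (colour p (fun x => N - q x)) A = prime_set (colour p q) A.
Proof.
move=> qN; apply: prime_congr => x y z _ _ _; have [->|yz] := eqVneq y z.
  by rewrite !eqxx.
rewrite !colourE // /same_side; have := (qN x, qN y, qN z) => -[[]].
by move=> *; congr andb; lia.
Qed.

Lemma inj_surj p : injective p -> (forall x, p x < #|T|) ->
  forall j, j < #|T| -> exists x, p x = j.
Proof.
move=> pI pL j jL; pose f x := Ordinal (pL x).
have fI : injective f by move=> x y /(congr1 val)/pI.
have [g fg gf] : bijective f by apply: inj_card_bij; rewrite ?card_ord.
by exists (g (Ordinal jL)); have := congr1 val (gf (Ordinal jL)).
Qed.

Section LeftmostPoint.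
Variables p q : T -> nat.
Hypotheses (pI : injective p) (qI : injective q).
Hypothesis pT : prime_set (colour p q) setT.

(* s is the leftmost point, u the next one and l the leftmost one below s. The
   points left of l are not a module, so that some v to the right of l has its
   height between s and some point left of l. *)
Lemma prime_quad_leftmost s u : p s = 0 -> p u = 1 -> q s < q u -> 2 < #|T| ->
  exists2 X : {set T}, prime_set (colour p q) X & #|X| = 4.
Proof.
move=> ps pu su T3.
have neq x y : p x != p y -> x != y by apply: contraNneq => ->.
have sNu : s != u by apply: neq; rewrite ps pu.
(* If [s] were lowest as well as leftmost, all other points would form a module. *)
have [l0 l0s] : exists l0, q l0 < q s.
  apply/existsP; apply: contraT => /existsPn N.
  have m : module (colour p q) setT (setT :\ s).
    apply/module_setD1P => y z _ _ ys zs _; have [->//|yz] := eqVneq y z.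
    apply/eqP; rewrite colourE // /same_side.
    have qn t : t != s -> (q s < q t) && (p s < p t).
      move=> ts; have := contra_neq (@qI _ _) ts; have := contra_neq (@pI _ _) ts.
      by move: (N t); lia.
    by move: (qn _ ys) (qn _ zs) => /andP[-> ->] /andP[-> ->].
  have [z] : exists z, z \in setT :\ s :\ u.
    apply/card_gt0P; have := cardsD1 s setT; have := cardsD1 u (setT :\ s).
    by rewrite cardsT !inE eq_sym sNu; lia.
  rewrite !inE => /and3P[zu zs _]; rewrite eq_sym in zu.
  have := prime_nomodule pT m (y := u) (z := z); rewrite !inE zs eq_sym sNu.
  by move/(_ isT isT zu)/setP/(_ s); rewrite !inE eqxx.
have [l ls lmin] := @arg_minnP T l0 (fun x => q x < q s) p l0s.
have pl t : p t < p l -> q s <= q t by move=> tl; have := lmin t; lia.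
have p1l : 1 < p l.
  have : p l != p s by apply: contraTneq ls => /pI->; rewrite ltnn.
  have : p l != p u by apply: contraTneq ls => /pI->; lia.
  by lia.
pose M := [set x | p x < p l].
have [v [w [wl lv sv vw]]] : exists v w, [/\ p w < p l, p l < p v, q s < q v & q v < q w].
  have [/existsP[v /existsP[w /and4P[]]]|N] := boolP
    [exists v, exists w, [&& p w < p l, p l < p v, q s < q v & q v < q w]].
    by exists v, w.
  have m : module (colour p q) setT M.
    apply/moduleP; split=> [|x y z _]; first exact: subsetT.
    rewrite !inE -leqNgt => xl yl zl; have [->//|yz] := eqVneq y z.
    apply/eqP; rewrite colourE // /same_side.
    have xs : p x != p s by apply: contraTneq xl; lia.
    have {}xs : q x != q s by apply: contra_neq xs => /qI->.
    have xy : q x != q y by apply: contraTneq xl => /qI->; lia.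
    have xz : q x != q z by apply: contraTneq xl => /qI->; lia.
    have xl' : (q x == q l) = (p x == p l) by apply/eqP/eqP => [/qI|/pI]->.
    have N' t : ~~ [&& p t < p l, p l < p x, q s < q x & q x < q t].
      by apply: contra N => h; apply/existsP; exists x; apply/existsP; exists t.
    by have := (N' y, N' z, pl y, pl z) => -[[[]]]; lia.
  have := prime_nomodule pT m (y := s) (z := u); rewrite !inE ps pu p1l ltnW //.
  by move/(_ isT isT sNu)/setP/(_ l); rewrite !inE ltnn.
(* Read from left to right, these points form the pattern 2413. *)
exists [set x in [:: s; w; l; v]].
  have ws : p w != p s by apply: contraTneq vw => /pI->; lia.
  by apply: prime_four; rewrite colourE ?neq // /same_side; lia.
have ws : p w != p s by apply: contraTneq vw => /pI->; lia.
rewrite cardsE; apply/eqP; have /card_uniqP : uniq [:: s; w; l; v]; last by move->.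
by rewrite /= !inE !negb_or !neq //; lia.
Qed.

End LeftmostPoint.

Lemma prime_quad_permutation p q : injective p -> injective q ->
  (forall x, p x < #|T|) -> 2 < #|T| -> prime_set (colour p q) setT ->
  exists2 X : {set T}, prime_set (colour p q) X & #|X| = 4.
Proof.
move=> pI qI pL T3 pT.
have [s ps] := inj_surj pI pL (ltnW (ltnW T3)).
have [u pu] := inj_surj pI pL (ltnW T3).
have : q s != q u by apply/eqP => /qI E; move: ps; rewrite E pu.
rewrite neq_ltn => /orP[su|us]; first exact: (prime_quad_leftmost pI qI pT ps pu).
(* Complementing the values puts the second point above the first and preserves prime sets. *)
pose N := \max_x q x; have qN x : q x <= N by apply: leq_bigmax.
have [|||X] := @prime_quad_leftmost p (fun x => N - q x) pI _ _ s u ps pu _ T3.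
- by move=> x y E; apply: qI; move: (qN x) (qN y) E; lia.
- by rewrite prime_colour_opp.
- by move: (qN s); lia.
- by rewrite prime_colour_opp //; exists X.
Qed.

End Points.

(** * Critical permutations *)

Definition critical (T : finType) (C : eqType) (c : T -> T -> C) : Prop :=
  prime_set c setT /\ forall x, ~~ prime_set c (setT :\ x).

(** With at most three points, a deletion has at most two and is trivially prime. *)
Lemma critical_card (T : finType) (C : eqType) (c : T -> T -> C) (x : T) :
  critical c -> 3 < #|T|.
Proof.
move=> [_ /(_ x)]; apply: contraNT; rewrite -leqNgt => T3.
by apply: prime_card2; have := cardsD1 x setT; rewrite inE cardsT; lia.
Qed.

(** The edges of what is known as the indecomposability graph. *)
Definition edge (T : finType) (C : eqType) (c : T -> T -> C) (x y : T) : bool :=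
  (x != y) && prime_set c (~: [set x; y]).

Lemma edgeC (T : finType) (C : eqType) (c : T -> T -> C) x y : edge c x y = edge c y x.
Proof. by rewrite /edge eq_sym setUC. Qed.

(** Restoring [x] to the prime complement of the edge gives [setT :\ y], which is not prime, so
    [prime_ext] applies. In its twin case, exchanging the twins turns the edge between [x] and [y]
    into one between [u] and [y]. *)
Lemma edge_step (T : finType) (C : eqType) (c : T -> T -> C) (x y : T) :
  (forall x y x' y', c x y = c x' y' -> c y x = c y' x') ->
  critical c -> edge c x y ->
  (forall u v, u \notin [set x; y] -> v \notin [set x; y] -> c x u = c x v) \/
  exists u, [/\ u != x, u != y, edge c u y &
                forall z, z != x -> z != y -> z != u -> c z x = c z u].
Proof.
move=> rev [pT N] /andP[xy p].
have E : x |: ~: [set x; y] = setT :\ y.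
  by apply/setP=> z; rewrite !inE; have [->|] := eqVneq z x; rewrite ?xy ?orbF ?andbT.
have xX : x \notin ~: [set x; y] by rewrite !inE eqxx.
have [|m|[u uX m]] := prime_ext p xX; first by rewrite E.
  left=> u v uX vX; have /moduleP[_] := m; apply; rewrite ?inE ?eqxx //=.
  - by rewrite -!in_set1 -in_setU.
  - by rewrite -!in_set1 -in_setU.
right; exists u; have [ux uy] : u != x /\ u != y.
  by move: uX; rewrite !inE negb_or => /andP.
move: m; rewrite E => m; have xA : x \in setT :\ y by rewrite !inE xy.
have uA : u \in setT :\ y by rewrite !inE uy.
have tw := elimT (module_pairP c xA uA) m.
split=> //; last by move=> z zx zy zu; apply: tw; rewrite // !inE zy.
rewrite /edge uy /=; have -> : ~: [set u; y] = setT :\ y :\ u.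
  by apply/setP=> z; rewrite !inE negb_or andbT.
apply: (prime_twin rev xA uA _ m); first by rewrite eq_sym.
by have <- : ~: [set x; y] = setT :\ y :\ x by apply/setP=> z; rewrite !inE negb_or andbT.
Qed.

Definition adjacent (T : finType) (p : T -> nat) (x y : T) : bool :=
  (p y == (p x).+1) || (p x == (p y).+1).

Lemma same_sideC (T : finType) (p : T -> nat) x y z : same_side p x y z = same_side p x z y.
Proof. by rewrite /same_side andbC [X in _ || X]andbC. Qed.

Section Coordinate.
Variables (T : finType) (p : T -> nat).
Hypotheses (pI : injective p) (pL : forall x, p x < #|T|).

Lemma adjacentP x y : x != y ->
  (forall z, z != x -> z != y -> same_side p z x y) -> adjacent p x y.
Proof.
move=> xy H; have pxy : p x != p y by apply: contraNneq xy => /pI->.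
have gap a b : p a < p b -> (forall z, z != a -> z != b -> same_side p z a b) ->
    p b = (p a).+1.
  move=> ab Hab; apply/eqP; rewrite eqn_leq ab andbT leqNgt; apply/negP => lt.
  have [z pz] := inj_surj pI pL (ltn_trans lt (pL b)).
  have za : z != a by apply/eqP => E; move: pz; rewrite E; lia.
  have zb : z != b by apply/eqP => E; move: pz lt; rewrite E; lia.
  by move: (Hab z za zb); rewrite /same_side pz; lia.
rewrite /adjacent; case: (ltngtP (p x) (p y)) pxy => // lt _.
  by rewrite (gap _ _ lt H) eqxx.
rewrite (gap y x lt) ?eqxx ?orbT // => z zy zx.
by move: (H z zx zy); rewrite /same_side; lia.
Qed.

Lemma corner_adjacent x y : x != y ->
  (forall z, z != x -> z != y -> ~~ same_side p x y z) -> adjacent p x y.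
Proof.
move=> xy H; apply: adjacentP => // z zx zy.
have := contra_neq (@pI _ _) zx; have := contra_neq (@pI _ _) zy.
by have := contra_neq (@pI _ _) xy; move: (H z zx zy); rewrite /same_side; lia.
Qed.

(** As [y] lies between [x] and [u], a point between [x] and [y] would also separate [x] from
    [u]. *)
Lemma between_adjacent x y u : x != y -> u != y -> ~~ same_side p y x u ->
  (forall z, z != x -> z != y -> z != u -> same_side p z x u) -> adjacent p x y.
Proof.
move=> xy uy N H; apply: adjacentP => // z zx zy.
have := contra_neq (@pI _ _) uy; have := contra_neq (@pI _ _) xy.
move: N; have [->|zu] := eqVneq z u; first by rewrite /same_side; lia.
by move: (H z zx zy zu); rewrite /same_side; lia.
Qed.

Lemma extreme_coordinate x :
  (forall z t, z != x -> t != x -> same_side p x z t) -> (p x == 0) || (p x == #|T|.-1).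
Proof.
move=> H; apply: contraT; rewrite negb_or => /andP[x0 xT].
have [z pz] := inj_surj pI pL (leq_ltn_trans (leq0n _) (pL x)).
have [|t pt] := inj_surj pI pL (j := #|T|.-1); first by have := pL x; lia.
have zx : z != x by apply: contraNneq x0 => <-; rewrite pz.
have tx : t != x by apply: contraNneq xT => <-; rewrite pt.
by have := H z t zx tx; have := pL x; rewrite /same_side pz pt; lia.
Qed.

End Coordinate.

(** * Edges of a critical permutation *)

Section Critical.
Variables (T : finType) (p q : T -> nat).
Hypotheses (pI : injective p) (pL : forall x, p x < #|T|).
Hypotheses (qI : injective q) (qL : forall x, q x < #|T|).
Local Notation c := (colour p q).
Hypothesis cr : critical c.

Lemma sideE x y z : x != y -> x != z ->
  c x y = c x z <-> same_side p x y z && same_side q x y z.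
Proof.
move=> xy xz; have [<-|yz] := eqVneq y z; last first.
  by split=> [/eqP|h]; [rewrite colourE | apply/eqP; rewrite colourE].
split=> // _; rewrite /same_side; have := contra_neq (@pI _ _) xy.
by have := contra_neq (@qI _ _) xy; lia.
Qed.

Lemma critical_edge (x0 : T) : exists x y, edge c x y.
Proof.
have T4 := critical_card x0 cr; have [pT N] := cr.
have [X pX cX] := prime_quad_permutation pI qI pL (ltnW T4) pT.
(* An odd [#|T|] would let the prime quadruple grow until a single point is left out. *)
have [oT|oT] := boolP (odd #|T|).
  have [|||x] := prime_deletion (@colour_rev _ p q) pT pX; rewrite ?cX ?oT //.
    by rewrite ltn_neqAle T4 andbT; apply: contraTneq oT => <-.
  by rewrite (negbTE (N x)).
have edgeI (Y : {set T}) : prime_set c Y -> #|~: Y| = 2 -> exists x y, edge c x y.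
  move=> pY /eqP/cards2P[x [y [xy E]]]; exists x, y.
  by rewrite /edge xy -E setCK.
have [T4e|T5] := eqVneq #|T| 4.
  have /card_gt1P[x [y [_ _ xy]]] : 1 < #|[set: T]| by rewrite cardsT T4e.
  exists x, y; rewrite /edge xy prime_card2 //.
  by have := cardsC [set x; y]; rewrite cards2 xy T4e; lia.
(* Now [#|T|] is even and at least 6, and this number of steps leads from 4 to [#|T| - 2]. *)
have [||Y pY cY] := prime_extend (k := (#|T| - 6)./2) (@colour_rev _ p q) pT pX.
- by rewrite cX.
- by rewrite cX; lia.
by apply: (edgeI Y pY); have := cardsC Y; lia.
Qed.

Lemma not_adjacent2 x y : x != y -> adjacent p x y -> adjacent q x y -> False.
Proof.
move=> xy pxy qxy; have T4 := critical_card x cr; have [pT _] := cr.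
have m : module c setT [set x; y].
  apply/module_pairP; rewrite ?inE // => z _ zx zy; apply/sideE => //.
  have := contra_neq (@pI _ _) zx; have := contra_neq (@pI _ _) zy.
  have := contra_neq (@qI _ _) zx; have := contra_neq (@qI _ _) zy.
  by move: pxy qxy; rewrite /adjacent /same_side; lia.
have := prime_nomodule pT m (set21 _ _) (set22 _ _) xy.
by move/(congr1 (fun A : {set T} => #|A|)); rewrite cards2 xy cardsT; lia.
Qed.

(** All points but [x] and [y] lie in one quadrant at [x]. If [y] lay there too, [setT :\ x] would
    be a module, so in some coordinate [y] is alone on its side of [x]. *)
Lemma corner_cut x y : x != y ->
  (forall u v, u \notin [set x; y] -> v \notin [set x; y] -> c x u = c x v) ->
  (forall z, z != x -> z != y -> ~~ same_side p x y z) \/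
  (forall z, z != x -> z != y -> ~~ same_side q x y z).
Proof.
move=> xy H; have T4 := critical_card x cr; have [pT _] := cr.
have [/existsP[z /and3P[zx zy h]]|N] :=
  boolP [exists z, [&& z != x, z != y & ~~ (same_side p x y z && same_side q x y z)]].
  have E t : t != x -> t != y -> same_side p x z t && same_side q x z t.
    by move=> tx ty; apply/sideE; rewrite 1?eq_sym //; apply: H; rewrite !inE negb_or ?zx ?tx.
  move: h; rewrite negb_and => /orP[h|h]; [left|right] => t tx ty; move: (E t tx ty) h;
    by rewrite /same_side; lia.
have m : module c setT (setT :\ x).
  apply/module_setD1P => u v _ _ ux vx _; apply/sideE; rewrite 1?eq_sym //.
  have E t : t != x -> (t == y) || (same_side p x y t && same_side q x y t).
    move=> tx; have [//|ty] := eqVneq t y; apply: contraR N => h.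
    by apply/existsP; exists t; rewrite tx ty.
  have qxy : q x != q y by apply: contra_neq xy => /qI.
  have pxy : p x != p y by apply: contra_neq xy => /pI.
  move: (E u ux) (E v vx); rewrite /same_side.
  by have [->|_] := eqVneq u y; have [->|_] := eqVneq v y => /=; lia.
have cT := cardsD1 x setT; rewrite inE cardsT in cT.
have /card_gt1P[u [v [uM vM uv]]] : 1 < #|setT :\ x| by lia.
by have /setP/(_ x) := prime_nomodule pT m uM vM uv; rewrite !inE eqxx.
Qed.

(** If [y] separated [x] from [u] in neither coordinate, [x] and [u] would form a module; if in
    both, [x], [y] and [u] would. *)
Lemma twin_cut x y u : u != x -> u != y -> x != y ->
  (forall z, z != x -> z != y -> z != u -> c z x = c z u) ->
  same_side p y x u (+) same_side q y x u.
Proof.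
move=> ux uy xy H; have T4 := critical_card x cr; have [pT _] := cr.
have S z : z != x -> z != y -> z != u -> same_side p z x u && same_side q z x u.
  by move=> zx zy zu; apply/sideE => //; apply: H.
have C3 : #|[set y; x; u]| <= 3 by rewrite -setUA cardsU1 cards2; case: (_ \notin _); lia.
have noM (M : {set T}) :
    x \in M -> u \in M -> M \subset [set y; x; u] -> module c setT M -> False.
  move=> xM uM /subset_leq_card sM m; have ME := prime_nomodule pT m xM uM.
  by move: sM; rewrite ME ?cardsT 1?eq_sym //; lia.
have np z t : z != t -> p z != p t by apply: contra_neq => /pI.
have nq z t : z != t -> q z != q t by apply: contra_neq => /qI.
apply/negPn/negP; case E : (same_side p y x u) => /= E'.
  apply: (noM [set x; u]); rewrite ?inE ?eqxx ?orbT //.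
    by apply/subsetP=> z; rewrite !inE => /orP[]->; rewrite !orbT.
  apply/module_pairP; rewrite ?inE // => z _ zx zu.
  have [->|zy] := eqVneq z y; last exact: H.
  by apply/sideE; rewrite 1?eq_sym // E; lia.
apply: (noM [set y; x; u]); rewrite ?inE ?eqxx ?orbT //.
apply/moduleP; split=> [|z a b _]; first exact: subsetT.
rewrite !inE !negb_or => /andP[/andP[zy zx] zu] ha hb.
have G t : [|| t == y, t == x | t == u] -> c z t = c z x.
  case/or3P=> /eqP->{t ha hb} //; last by rewrite H.
  apply/sideE => //; move: (S z zx zy zu) E E'; rewrite /same_side.
  by have := (np _ _ ux, np _ _ uy, np _ _ xy, nq _ _ ux, nq _ _ uy, nq _ _ xy); lia.
by rewrite (G a) ?(G b) // orbA.
Qed.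

Lemma edge_adjacent x y : edge c x y -> adjacent p x y || adjacent q x y.
Proof.
move=> e; have /andP[xy _] := e.
have [H|[u [ux uy _ H]]] := edge_step (@colour_rev _ p q) cr e.
  by have [h|h] := corner_cut xy H; apply/orP; [left|right]; apply: corner_adjacent.
have S z : z != x -> z != y -> z != u -> same_side p z x u && same_side q z x u.
  by move=> zx zy zu; apply/sideE => //; apply: H.
have := twin_cut ux uy xy H; case P : (same_side p y x u) => /= Q; apply/orP.
  by right; apply: (between_adjacent qI qL xy uy Q) => z zx zy zu; case/andP: (S z zx zy zu).
left; apply: (between_adjacent pI pL xy uy); first by rewrite P.
by move=> z zx zy zu; case/andP: (S z zx zy zu).
Qed.

(** By [not_adjacent2] the pair is not adjacent in [q], so the cut is in [p]. Either [y] is at an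
    end, or [u] is the mirror image of [x] in [y]. *)
Lemma edge_adjacent_step x y : edge c x y -> adjacent p x y ->
  ((forall z, z != x -> z != y -> ~~ same_side p x y z) /\ ((q x == 0) || (q x == #|T|.-1)))
  \/ exists u, [/\ u != x, p x + p u = (p y).*2, edge c u y & adjacent q x u].
Proof.
move=> e axy; have /andP[xy _] := e.
have Nq : ~ adjacent q x y by apply: not_adjacent2.
have [H|[u [ux uy euy H]]] := edge_step (@colour_rev _ p q) cr e.
  have E z t : z != x -> z != y -> t != x -> t != y -> same_side p x z t && same_side q x z t.
    move=> zx zy tx ty; apply/sideE; rewrite 1?eq_sym //.
    by apply: H; rewrite !inE negb_or ?zx ?tx.
  have nq t : t != x -> q t != q x by apply: contra_neq => /qI.
  left; split.
    have [//|h] := corner_cut xy H; case: Nq; exact: corner_adjacent.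
  have Q z : z != x -> z != y -> same_side q x y z.
    move=> zx zy; apply: contraT => N; case: Nq.
    apply: corner_adjacent => // t tx ty; move: N (E z t zx zy tx ty) (nq z zx) (nq t tx).
    by rewrite /same_side; lia.
  have {}Q z : z != x -> same_side q x y z.
    move=> zx; have [->|zy] := eqVneq z y; last exact: Q.
    by have := nq y; rewrite eq_sym xy /same_side => /(_ isT); lia.
  apply: extreme_coordinate => // z t zx tx.
  by move: (Q z zx) (Q t tx); rewrite /same_side; lia.
have S z : z != x -> z != y -> z != u -> same_side p z x u && same_side q z x u.
  by move=> zx zy zu; apply/sideE => //; apply: H.
have Sp z : z != x -> z != y -> z != u -> same_side p z x u.
  by move=> zx zy zu; case/andP: (S z zx zy zu).
have Sq z : z != x -> z != y -> z != u -> same_side q z x u.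
  by move=> zx zy zu; case/andP: (S z zx zy zu).
right; exists u; have := twin_cut ux uy xy H; case P : (same_side p y x u) => /= Q.
  by case: Nq; apply: (between_adjacent qI qL xy uy Q).
have auy : adjacent p u y.
  apply: (between_adjacent pI pL uy xy) => [|z zu zy zx]; first by rewrite same_sideC P.
  by rewrite same_sideC Sp.
split=> //; first by move: P axy auy; rewrite /same_side /adjacent; lia.
apply: adjacentP => // [|z zx zu]; first by rewrite eq_sym.
by have [->|zy] := eqVneq z y; last exact: Sq.
Qed.

(** Here [z] is the mirror image of [x] in [y]; the corner case fails because [y] and [z] are on the
    same side of [x]. *)
Lemma edge_right x y z : edge c x y -> p y = (p x).+1 -> p z = (p y).+1 -> edge c y z.
Proof.
move=> e pxy pyz.
have axy : adjacent p x y by rewrite /adjacent pxy eqxx.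
have [[H _]|[u [_ pu euy _]]] := edge_adjacent_step e axy.
  have zx : z != x by apply/eqP => E; move: pyz; rewrite E; lia.
  have zy : z != y by apply/eqP => E; move: pyz; rewrite E; lia.
  by move: (H z zx zy); rewrite /same_side; lia.
by rewrite edgeC; have <- : u = z by apply: pI; lia.
Qed.

Lemma edge_left x y z : edge c x y -> p y = (p x).+1 -> p x = (p z).+1 -> edge c z x.
Proof.
rewrite edgeC => e pxy pzx.
have axy : adjacent p y x by rewrite /adjacent pxy eqxx orbT.
have [[H _]|[u [_ pu euy _]]] := edge_adjacent_step e axy.
  have zx : z != x by apply/eqP => E; move: pzx; rewrite E; lia.
  have zy : z != y by apply/eqP => E; move: pzx; rewrite E; lia.
  by move: (H z zy zx); rewrite /same_side; lia.
by have <- : u = z by apply: pI; lia.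
Qed.

Lemma consecutive_edge x0 y0 x y : edge c x0 y0 -> adjacent p x0 y0 ->
  p y = (p x).+1 -> edge c x y.
Proof.
move=> e0 a0 pxy.
have {x0 y0 e0 a0} [x0 [y0 [e0 p0]]] : exists x y, edge c x y /\ p y = (p x).+1.
  case/orP: a0 => /eqP E; first by exists x0, y0.
  by exists y0, x0; rewrite edgeC.
have [le|lt] := leqP (p x0) (p x).
  have [k kE] : exists k, p x = p x0 + k by exists (p x - p x0); lia.
  elim: k x y kE pxy {le} => [|k IH] x y pk pxy.
    by have [-> ->] : x = x0 /\ y = y0 by split; apply: pI; lia.
  have [|z pz] := inj_surj pI pL (j := p x0 + k); first by have := pL x; lia.
  by apply: (@edge_right z); rewrite ?(IH z x) //; lia.
have [k kE] : exists k, p x0 = p x + k by exists (p x0 - p x); lia.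
elim: k x y kE pxy {lt} => [|k IH] x y pk pxy.
  by have [-> ->] : x = x0 /\ y = y0 by split; apply: pI; lia.
have [|z pz] := inj_surj pI pL (j := (p y).+1).
  by have := pL y0; lia.
by apply: (@edge_left y z); rewrite ?(IH y z) //; lia.
Qed.

(** For entries at distance 2, the mirror case is applied to the entry between them. For the second
    and the last but one entries, paired with the end next to them, the mirror image would fall
    outside the range, which leaves the corner case. *)
Lemma critical_values x0 y0 : edge c x0 y0 -> adjacent p x0 y0 ->
  [/\ forall x z, p z = (p x).+2 -> adjacent q x z,
      forall x, p x = 1 -> (q x == 0) || (q x == #|T|.-1)
    & forall x, p x = #|T| - 2 -> (q x == 0) || (q x == #|T|.-1)].
Proof.
move=> e0 a0; have T4 := critical_card x0 cr; split=> [x z pxz|x px|x px].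
- have [|y py] := inj_surj pI pL (j := (p x).+1); first by have := pL z; lia.
  have axy : adjacent p x y by rewrite /adjacent py eqxx.
  have [[H _]|[u [_ pu _ aq]]] := edge_adjacent_step (consecutive_edge e0 a0 py) axy.
    have zx : z != x by apply/eqP => E; move: pxz; rewrite E; lia.
    have zy : z != y by apply/eqP => E; move: pxz; rewrite E; lia.
    by move: (H z zx zy); rewrite /same_side; lia.
  by have <- : u = z by apply: pI; lia.
- have [|y py] := inj_surj pI pL (j := 0); first by lia.
  have axy : adjacent p x y by rewrite /adjacent py px.
  have e : edge c x y by rewrite edgeC; apply: (consecutive_edge e0 a0); lia.
  by have [[_ H]|[u [_ pu _ _]]] := edge_adjacent_step e axy; [| lia].
- have [|y py] := inj_surj pI pL (j := #|T|.-1); first by lia.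
  have pyx : p y = (p x).+1 by lia.
  have axy : adjacent p x y by rewrite /adjacent pyx eqxx.
  have [[_ H]|[u [_ pu _ _]]] := edge_adjacent_step (consecutive_edge e0 a0 pyx) axy => //.
  by have := pL u; lia.
Qed.

End Critical.

(* The inverse of the parallel alternation of length 2m, with letters and positions
   counted from 0. *)
Definition alt (m j : nat) : nat := if odd j then j./2 else m + j./2.

Lemma alt_values0 n (f : nat -> nat) : 3 < n -> (forall j, j < n -> f j < n) ->
  (forall i j, i < n -> j < n -> f i = f j -> i = j) ->
  (forall j, j.+2 < n -> f j.+2 = (f j).+1 \/ f j = (f j.+2).+1) ->
  f 1 = 0 -> f (n - 2) = 0 \/ f (n - 2) = n.-1 ->
  exists2 m, n = m.*2 & forall j, j < n -> f j = alt m j.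
Proof.
move=> n4 fL fI fA f1 fn.
(* Odd positions count upwards from 0: a step down would repeat the value of an earlier odd
   position. *)
have fo i : i.*2.+1 < n -> f i.*2.+1 = i.
  elim/ltn_ind: i => -[|i] IH lt //.
  have Ei : f i.*2.+1 = i by apply: IH; lia.
  have [|E|E] := fA i.*2.+1; [lia | by rewrite doubleS E Ei |].
  rewrite Ei in E; have := fI i.*2.+3 (f i.*2.+3).*2.+1.
  by rewrite (IH (f i.*2.+3)); [move=> /(_ _ _ erefl); lia | lia | lia].
(* For odd [n], position [n - 2] would be odd, with a value that is not extreme. *)
have nE : ~~ odd n.
  apply/negP => on; have E : n - 2 = (n - 3)./2.*2.+1.
    by have := odd_double_half n; rewrite on; lia.
  by move: fn; rewrite E fo; lia.
have [m nm] : exists m, n = m.*2 by exists n./2; rewrite -[LHS]odd_double_half (negbTE nE).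
exists m => //; subst n.
(* Even positions are treated from the right end, where the value is the maximum, and count
   downwards for the same reason. *)
have fe i : i < m -> f (m.-1 - i).*2 = m.*2.-1 - i.
  elim/ltn_ind: i => -[|i] IH lt.
    rewrite !subn0 (_ : m.-1.*2 = m.*2 - 2); last by lia.
    by case: fn => // F0; have := fI (m.*2 - 2) 1; rewrite f1 F0; lia.
  set j := (m.-1 - i.+1).*2; have jE : j.+2 = (m.-1 - i).*2 by rewrite /j; lia.
  have Ej : f j.+2 = m.*2.-1 - i by rewrite jE IH //; lia.
  have jm : j.+2 < m.*2 by rewrite jE; lia.
  have [|E|E] := fA j; [by [] | by lia |].
  case: i IH lt @j jE Ej jm E => [|i] IH lt j jE Ej jm E; first by have := fL j; lia.
  have Ei : f (m.-1 - i).*2 = m.*2.-1 - i by apply: IH; lia.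
  by have := fI j (m.-1 - i).*2; lia.
move=> j jm; rewrite /alt; case: ifP => oj.
  have jE : j = j./2.*2.+1 by rewrite -[LHS]odd_double_half oj.
  by rewrite {1}jE fo // -jE.
have jE : j = j./2.*2 by rewrite -[LHS]odd_double_half oj.
have := fe (m.-1 - j./2); rewrite subKn; last by lia.
by rewrite -jE => -> //; lia.
Qed.

Lemma alt_values n (f : nat -> nat) : 3 < n -> (forall j, j < n -> f j < n) ->
  (forall i j, i < n -> j < n -> f i = f j -> i = j) ->
  (forall j, j.+2 < n -> f j.+2 = (f j).+1 \/ f j = (f j.+2).+1) ->
  f 1 = 0 \/ f 1 = n.-1 -> f (n - 2) = 0 \/ f (n - 2) = n.-1 ->
  exists2 m, n = m.*2 & (forall j, j < n -> f j = alt m j) \/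
                        (forall j, j < n -> f j = n.-1 - alt m j).
Proof.
move=> n4 fL fI fA [f1|f1] fn.
  by have [m nE H] := alt_values0 n4 fL fI fA f1 fn; exists m; [|left].
have [|||||m nE H] := @alt_values0 n (fun j => n.-1 - f j) n4.
- by move=> j jn; have := fL j jn; lia.
- by move=> i j ni nj E; apply: fI => //; have := (fL i ni, fL j nj) => -[]; lia.
- by move=> j jn; have := fA j jn; have := (fL j, fL j.+2) => -[]; lia.
- by rewrite f1 subnn.
- by move: fn; lia.
by exists m => //; right=> j jn; rewrite -H //; have := fL j jn; lia.
Qed.

Section PermutationCoordinates.
Variable T : finType.
Implicit Types p q : T -> nat.

Definition alternates m p q : Prop :=
  (forall x, q x = alt m (p x)) \/ (forall x, q x = m.*2.-1 - alt m (p x)).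

Lemma critical_alternates p q x y : injective p -> (forall x, p x < #|T|) ->
  injective q -> (forall x, q x < #|T|) -> critical (colour p q) ->
  edge (colour p q) x y -> adjacent p x y -> exists2 m, #|T| = m.*2 & alternates m p q.
Proof.
move=> pI pL qI qL cr e a; have n4 := critical_card x cr.
have [H0 H1 H2] := critical_values pI pL qI qL cr e a.
(* The inverse of [p]; the default [x] is never reached for [j < #|T|]. *)
pose s j := odflt x [pick z | p z == j].
have sK j : j < #|T| -> p (s j) = j.
  move=> jn; rewrite /s; case: pickP => [z /eqP//|N].
  by have [z /eqP] := inj_surj pI pL jn; rewrite N.
have ps z : s (p z) = z by apply: pI; rewrite sK.
have [|||||m nE H] := @alt_values #|T| (fun j => q (s j)) n4.
- by move=> j _; apply: qL.
- by move=> i j ni nj /qI/(congr1 p); rewrite !sK.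
- move=> j jn; have := H0 (s j) (s j.+2); rewrite !sK; [|lia|lia].
  by move=> /(_ erefl)/orP[]/eqP; [left|right].
- by have := H1 (s 1); rewrite sK; [move=> /(_ erefl)/orP[]/eqP; [left|right] | lia].
- by have := H2 (s (#|T| - 2)); rewrite sK; [move=> /(_ erefl)/orP[]/eqP; [left|right] | lia].
exists m => //; rewrite /alternates -nE.
by case: H => H; [left|right] => z; rewrite -{1}(ps z) H.
Qed.

Theorem critical_permutation p q (x0 : T) : injective p -> (forall x, p x < #|T|) ->
  injective q -> (forall x, q x < #|T|) -> critical (colour p q) ->
  exists2 m, #|T| = m.*2 & alternates m p q \/ alternates m q p.
Proof.
move=> pI pL qI qL cr; have [x [y e]] := critical_edge pI pL qI cr x0.
case/orP: (edge_adjacent pI pL qI qL cr e) => a.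
  by have [m Tm H] := critical_alternates pI pL qI qL cr e a; exists m; [|left].
have cr' : critical (colour q p).
  by case: cr => pT N; split=> [|x']; rewrite prime_colour_swap.
have e' : edge (colour q p) x y by rewrite /edge prime_colour_swap.
by have [m Tm H] := critical_alternates qI qL pI pL cr' e' a; exists m; [|right].
Qed.

End PermutationCoordinates.

(** * Cayley permutations as 2-structures *)

Lemma same_side_neq (T : finType) (p : T -> nat) x y z : same_side p x y z -> p x != p y.
Proof. by rewrite /same_side; lia. Qed.

Lemma same_side_between (T : finType) (p : T -> nat) x y z :
  p y <= p x <= p z -> same_side p x y z = false.
Proof. by rewrite /same_side; lia. Qed.

(** Stated for a subset [A] with a numbering [g] of its points, so as to cover both a word and its
    deletions. An H-interval gives a module because an outside point misses both intervals.
    Conversely, a module with two points contains every point within its range of positions or of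
    values. *)
Lemma simple_prime (T : finType) (A : {set T}) (g : T -> nat) (v : seq nat) :
  cayley v -> {in A &, injective g} -> {in A, forall x, g x < size v} ->
  (forall i, i < size v -> exists2 x, x \in A & g x = i) ->
  simple v <-> prime_set (colour g (fun x => nth 0 v (g x))) A.
Proof.
set q := fun x => nth 0 v (g x); move=> [m _ vE] gI gL gS.
have letter t : (t \in v) = (0 < t <= m) by rewrite vE mem_iota add1n ltnS.
split=> [sv|pA]; last first.
  move=> a b [/andP[ab bv] [c [d [im preim]]]].
  have [xa xaA ga] := gS a (leq_ltn_trans ab bv); have [xb xbA gb] := gS b bv.
  pose M := [set x in A | a <= g x <= b].
  have mM : module (colour g q) A M.
    apply/moduleP; split=> [|x y z xA]; first by apply/subsetP=> x; rewrite inE => /andP[].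
    rewrite !inE xA /= => xM /andP[yA yM] /andP[zA zM]; have [->//|yz] := eqVneq y z.
    apply/eqP; rewrite colourE //.
    have := preim _ (gL y yA); have := preim _ (gL z zA); have := preim _ (gL x xA).
    by rewrite yM zM (negbTE xM); move: xM yM zM; rewrite /same_side /q; clear; lia.
  have xaM : xa \in M by rewrite inE xaA ga leqnn.
  have xbM : xb \in M by rewrite inE xbA gb leqnn andbT.
  have [E|xab] := eqVneq xa xb; [by left; rewrite -ga E | right].
  have ME := prime_nomodule pA mM xaM xbM xab.
  have lt0 := leq_ltn_trans (leq0n _) bv.
  have [x xA gx] := gS 0 lt0.
  have [|y yA gy] := gS (size v).-1; first by rewrite prednK.
  move: xA yA; rewrite -ME !inE gx gy leqn0 => /and3P[_ /eqP-> _] /and3P[_ _ vb].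
  by split=> //; apply: anti_leq; rewrite bv -(prednK lt0).
apply/prime_setP => M /moduleP[sM H].
have [M1|/card_gt1P[x0 [x1 [x0M x1M x01]]]] := leqP #|M| 1; [by left | right].
have mA x : x \in M -> x \in A by apply: (subsetP sM).
have [xa xaM amin] := @arg_minnP T x0 (mem M) g x0M.
have [xb xbM bmax] := @arg_maxnP T x0 (mem M) g x0M.
have [yc ycM cmin] := @arg_minnP T x0 (mem M) q x0M.
have [yd ydM dmax] := @arg_maxnP T x0 (mem M) q x0M.
have S x y z : x \in A -> x \notin M -> y \in M -> z \in M -> y != z ->
    same_side g x y z && same_side q x y z.
  by move=> xA xM yM zM yz; rewrite -colourE //; apply/eqP/H.
have inP x : x \in A -> g xa <= g x <= g xb -> x \in M.
  move=> xA gx; apply: contraT => xM; have [E|ab] := eqVneq xa xb.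
    case/negP: xM; rewrite (_ : x = xa) //; apply: gI => //; first exact: mA.
    by apply: anti_leq; rewrite andbC {2}E.
  by move: (S x xa xb xA xM xaM xbM ab); rewrite same_side_between.
have inQ x : x \in A -> q yc <= q x <= q yd -> x \in M.
  (* If [yc] and [yd] coincide, [x] is tied with [yc]. A second point z of [M] then gives a
     contradiction, as a tied pair has a colour of its own. *)
  move=> xA qx; apply: contraT => xM; have [E|cd] := eqVneq yc yd; last first.
    by move: (S x yc yd xA xM ycM ydM cd); rewrite (same_side_between qx) andbF.
  have [z zM yz] : exists2 z, z \in M & yc != z.
    by have [yx0|] := eqVneq yc x0; [exists x1; rewrite ?yx0 | exists x0].
  have /andP[_ /same_side_neq] := S x yc z xA xM ycM zM yz.
  by rewrite eqn_leq andbC {2}E qx.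
have hI : Hinterval v (g xa) (g xb).
  split; first by rewrite amin //= gL // mA.
  exists (q yc), (q yd); split=> [t|i iv].
    split=> [[i ib <-]|tb].
      have [x xA gx] : exists2 x, x \in A & g x = i.
        by apply: gS; have := gL xb (mA _ xbM); lia.
      have xM : x \in M by apply: inP; rewrite ?gx.
      by rewrite -gx; apply/andP; split; [apply: cmin | apply: dmax].
    (* A number between two letters is a letter, as [v] is a Cayley permutation. *)
    have tv : t \in v.
      have qc : q yc \in v by rewrite mem_nth // gL // mA.
      have qd : q yd \in v by rewrite mem_nth // gL // mA.
      by move: qc qd; rewrite !letter; lia.
    have [x xA gx] : exists2 x, x \in A & g x = index t v by apply: gS; rewrite index_mem.
    have qx : q x = t by rewrite /q gx nth_index.
    have xM : x \in M by apply: inQ; rewrite ?qx.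
    exists (g x); last exact: qx.
    by apply/andP; split; [apply: amin | apply: bmax].
  have [x xA gx] := gS i iv; rewrite -gx -/(q x).
  have [xM|xM] := boolP (x \in M).
    have -> : g xa <= g x <= g xb by apply/andP; split; [apply: amin | apply: bmax].
    by apply/andP; split; [apply: cmin | apply: dmax].
  by apply/idP/idP => h; case/negP: xM; [apply: inQ | apply: inP].
have [ab|[a0 bv]] := sv _ _ hI.
  case/negP: x01; apply/eqP/gI; rewrite ?mA //.
  apply/eqP; rewrite eqn_leq (leq_trans (bmax _ x0M)) ?(leq_trans (bmax _ x1M)) //.
    by rewrite -ab; apply: amin.
  by rewrite -ab; apply: amin.
apply/eqP; rewrite eqEsubset sM; apply/subsetP=> x xA; apply: inP => //.
by rewrite a0 /= -ltnS bv; apply: gL.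
Qed.

Lemma ltn_st (u : seq nat) i j : i < size u -> j < size u ->
  (nth 0 (st u) i < nth 0 (st u) j) = (nth 0 u i < nth 0 u j).
Proof.
move=> iu ju; rewrite !(nth_map 0) // ltnS; set s := sort leq (undup u).
have mem k : k < size u -> nth 0 u k \in s by move=> ku; rewrite mem_sort mem_undup mem_nth.
have ss : sorted ltn s.
  by rewrite ltn_sorted_uniq_leq sort_uniq undup_uniq sort_sorted //; apply: leq_total.
apply/idP/idP => [|lt]; first by apply: (sorted_ltn_index ltn_trans ss); apply: mem.
rewrite ltnNge; apply: contraTN lt => le; rewrite -leqNgt.
have ss' : sorted leq s by rewrite sort_sorted //; apply: leq_total.
by apply: (sorted_leq_index leq_trans leqnn ss') le; apply: mem.
Qed.

Lemma size_st u : size (st u) = size u. Proof. by rewrite size_map. Qed.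

Lemma cayley_st u : cayley (st u).
Proof.
exists (size (undup u)); first by rewrite size_st size_undup.
move=> t; rewrite mem_iota add1n ltnS; apply/mapP/andP => [[x xu ->]|].
  split=> //; rewrite -(size_sort leq) index_mem mem_sort mem_undup //.
case: t => [[]//|t [_ tu]]; exists (nth 0 (sort leq (undup u)) t).
  by rewrite -mem_undup -(mem_sort leq) mem_nth // size_sort.
by rewrite index_uniq ?size_sort // sort_uniq undup_uniq.
Qed.

Definition word_colour (w : seq nat) : 'I_(size w) -> 'I_(size w) -> _ :=
  colour (@nat_of_ord (size w)) (fun i => nth 0 w i).

Arguments word_colour : clear implicits.

Lemma simpleP w : cayley w -> simple w <-> prime_set (word_colour w) setT.
Proof.
move=> cw; apply: (simple_prime cw); first by move=> i j _ _; apply: val_inj.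
  by move=> i _; apply: ltn_ord.
by move=> i iw; exists (Ordinal iw).
Qed.

(** The numbering [unbump k] closes the gap at [k]. It keeps the order of the other positions, and
    [st] keeps that of the letters. *)
Lemma simple_deletionP w (k : 'I_(size w)) :
  simple (deletion w k) <-> prime_set (word_colour w) (setT :\ k).
Proof.
set u := take k w ++ drop k.+1 w; have kw := ltn_ord k.
have su : size u = (size w).-1 by rewrite size_cat size_take kw size_drop; lia.
have nu (i : 'I_(size w)) : i != k -> nth 0 u (unbump k i) = nth 0 w i.
  move=> ik; have {ik} : nat_of_ord i != k by [].
  rewrite nth_cat size_take kw /unbump; case: (ltngtP k i) => // [ki|ik] _.
    by rewrite ifN ?nth_drop; [congr nth; lia | lia].
  by rewrite subn0 ik nth_take.
have gL : {in setT :\ k, forall i : 'I_(size w), unbump k i < size (deletion w k)}.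
  move=> i; rewrite !inE andbT => ik; have {ik} : nat_of_ord i != k by [].
  by rewrite size_st su /unbump; have := ltn_ord i; lia.
rewrite (@simple_prime _ (setT :\ k) (fun i => unbump k i)); first last.
- rewrite size_st su => i iw; have bw : bump k i < size w by rewrite /bump; lia.
  exists (Ordinal bw); last by rewrite /= bumpK.
  by rewrite !inE andbT -val_eqE /= eq_sym neq_bump.
- exact: gL.
- move=> i j; rewrite !inE !andbT -!val_eqE /= => ik jk E; apply: val_inj => /=.
  by move: E ik jk; rewrite /unbump; lia.
- exact: cayley_st.
rewrite (@prime_congr _ _ _ _ (word_colour w)) // => x y z xA yA zA.
have [->|yz] := eqVneq y z; first by rewrite !eqxx.
rewrite !colourE //; congr andb; rewrite /same_side.
  move: xA yA zA; rewrite !inE !andbT -!val_eqE /= /unbump; lia.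
have L (i j : 'I_(size w)) : i \in setT :\ k -> j \in setT :\ k ->
    (nth 0 (deletion w k) (unbump k i) < nth 0 (deletion w k) (unbump k j)) =
    (nth 0 w i < nth 0 w j).
  move=> iA jA; have [ik jk] : i != k /\ j != k by move: iA jA; rewrite !inE !andbT.
  by move: (gL i iA) (gL j jA); rewrite size_st => li lj; rewrite ltn_st ?nu.
by rewrite !L.
Qed.

(** * Parallel alternations and their symmetries *)

Lemma alt_lt m j : j < m.*2 -> alt m j < m.*2.
Proof. by rewrite /alt; have := odd_double_half j; case: odd; lia. Qed.

(** Invariance under reverse-complement: reversal and complement have the same effect, which leaves
    four symmetries instead of eight. *)
Lemma alt_opp m j : j < m.*2 -> alt m (m.*2.-1 - j) = m.*2.-1 - alt m j.
Proof.
move=> jm; rewrite /alt; have := odd_double_half j.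
by have := odd_double_half (m.*2.-1 - j); case: odd; case: odd; lia.
Qed.

Lemma alt_inj m i j : i < m.*2 -> j < m.*2 -> alt m i = alt m j -> i = j.
Proof.
by rewrite /alt; have := odd_double_half j; have := odd_double_half i; do 2!case: odd; lia.
Qed.

(** * Parallel alternations are critical *)

Section Converse.
Variables (T : finType) (p q : T -> nat) (m : nat).
Hypotheses (m2 : 1 < m) (Tm : #|T| = m.*2).
Hypotheses (pI : injective p) (pL : forall x, p x < m.*2).

Lemma at_pos j : j < m.*2 -> exists x, p x = j.
Proof. by move=> jm; apply: inj_surj; rewrite ?Tm. Qed.

Lemma alt_critical : (forall x, q x = alt m (p x)) -> critical (colour p q).
Proof.
move=> qE; split=> [|x].
  apply/prime_setP => M mM; have /moduleP[_ H] := mM.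
  (* Modules are convex in both coordinates, since a point between two others sees them
     differently. *)
  have cv x y z : y \in M -> z \in M ->
      (p y <= p x <= p z) || (q y <= q x <= q z) -> x \in M.
    move=> yM zM xyz; apply: contraT => xM; have [E|yz] := eqVneq y z.
      suff E' : x = y by rewrite E' yM in xM.
      apply: pI; move: xyz; rewrite -E => /orP[xyx|qx]; first by lia.
      by apply: (alt_inj (m := m)) => //; move: qx; rewrite !qE; lia.
    have /eqP := H x y z (in_setT _) xM yM zM; rewrite colourE //.
    by case/orP: xyz => /same_side_between->; rewrite ?andbF.
  have [M1|/card_gt1P[x [y [xM yM xy]]]] := leqP #|M| 1; [by left | right].
  have [a [b [aM bM pab]]] : exists a b, [/\ a \in M, b \in M & p b = (p a).+1].
    have : p x != p y by apply: contraNneq xy => /pI->.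
    rewrite neq_ltn => /orP[lt|lt].
      have [|b pb] := @at_pos (p x).+1; first by have := pL y; lia.
      by exists x, b; rewrite pb (cv b x y) // pb; lia.
    have [|b pb] := @at_pos (p y).+1; first by have := pL x; lia.
    by exists y, b; rewrite pb (cv b y x) // pb; lia.
  (* The first and the last position hold the two middle values, which lie between the values of any
     two consecutive positions. So a module with two points contains both ends, hence everything. *)
  have [s ps] : exists s, p s = 0 by apply: at_pos; lia.
  have [e pe] : exists e, p e = m.*2.-1 by apply: at_pos; lia.
  have qs : q s = m by rewrite qE ps /alt addn0.
  have qe : q e = m.-1.
    rewrite qE pe /alt; have -> : m.*2.-1 = m.-1.*2.+1 by lia.
    by rewrite /= odd_double uphalf_double.
  have [sM eM] : s \in M /\ e \in M.
    have qa := qE a; have qb := qE b; have la := pL a; have lb := pL b.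
    move: qa qb; rewrite /alt pab /= uphalf_half; have := odd_double_half (p a).
    case: (odd (p a)) => /= pa qa qb; split.
    - by apply: (cv s a b) => //; rewrite qs; lia.
    - by apply: (cv e a b) => //; rewrite qe; lia.
    - by apply: (cv s b a) => //; rewrite qs; lia.
    - by apply: (cv e b a) => //; rewrite qe; lia.
  apply/setP=> z; rewrite inE; apply: (cv z s e) => //.
  by have := pL z; rewrite ps pe; lia.
have cT (A : {set T}) : A = setT :\ x -> #|A| = m.*2.-1.
  by move=> ->; have := cardsD1 x setT; rewrite inE cardsT Tm; lia.
have neq a b : p a != p b -> a != b by apply: contraNneq => ->.
have pz z t : z != t -> p z != p t by apply: contra_neq => /pI.
have qz z t : z != t -> q z != q t.
  by apply: contra_neq; rewrite !qE => /alt_inj E; apply/pI/E.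
(* Once an end is deleted, its neighbour [a] is a corner, and the remaining points form a module. *)
have [bd|mid] := boolP ((p x == 0) || (p x == m.*2.-1)).
  have [a [ax Ha]] : exists a, a != x /\
      ((forall z, z != x -> z != a -> p a < p z /\ q a < q z) \/
       (forall z, z != x -> z != a -> p z < p a /\ q z < q a)).
    case/orP: bd => /eqP px.
      have [a pa] : exists a, p a = 1 by apply: at_pos; lia.
      have qa : q a = 0 by rewrite qE pa.
      exists a; rewrite neq ?pa ?px //; split=> //; left=> z zx za.
      move: (pz _ _ zx) (pz _ _ za) (qz _ _ za); rewrite px pa qa.
      by clear; lia.
    have [a pa] : exists a, p a = m.*2 - 2 by apply: at_pos; lia.
    have qa : q a = m.*2.-1.
      by rewrite qE pa (_ : _ - 2 = m.-1.*2) ?/alt ?odd_double ?doubleK; lia.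
    exists a; rewrite neq ?pa ?px; last by lia.
    split=> //; right=> z zx za; have lz := pL z; have := alt_lt (pL z); rewrite -qE.
    move: (pz _ _ zx) (pz _ _ za) (qz _ _ za) lz; rewrite px pa qa.
    by clear; lia.
  have aA : a \in setT :\ x by rewrite !inE andbT.
  apply/prime_setPn; exists (setT :\ x :\ a).
  have cA := cardsD1 a (setT :\ x); rewrite aA (cT _ erefl) in cA.
  split; [|by lia|]; last first.
    by apply/eqP => E; move: aA; rewrite -E !inE eqxx.
  apply/module_setD1P => u v; rewrite !inE !andbT => ux vx ua va _.
  have [->//|uv] := eqVneq u v; apply/eqP; rewrite colourE // /same_side.
  by case: Ha => H; have [-> ->] := H u ux ua; have [-> ->] := H v vx va; rewrite ?orbT.
(* Once an inner point is deleted, its two neighbours are consecutive in position and in value. *)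
have [a pa] : exists a, p a = (p x).-1 by apply: at_pos; have := pL x; lia.
have [b pb] : exists b, p b = (p x).+1 by apply: at_pos; have := pL x; lia.
have ab : a != b by apply: neq; lia.
have aA : a \in setT :\ x by rewrite !inE andbT neq //; lia.
have bA : b \in setT :\ x by rewrite !inE andbT neq //; lia.
have mab : module (colour p q) (setT :\ x) [set a; b].
  apply/module_pairP => // z; rewrite !inE andbT => zx za zb; apply/eqP; rewrite colourE //.
  have qab : (q b == (q a).+1) || (q a == (q b).+1).
    rewrite !qE /alt pa pb; have := odd_double_half (p x).-1.
    by have := odd_double_half (p x).+1; case: odd; case: odd; lia.
  move: (pz _ _ zx) (pz _ _ za) (pz _ _ zb) (qz _ _ za) (qz _ _ zb) qab pa pb mid.
  by rewrite /same_side; clear; lia.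
apply/prime_setPn; exists [set a; b]; rewrite mab cards2 ab; split=> //.
by apply: contraTneq ab => /cT; rewrite cards2; case: (_ != _) => //; lia.
Qed.

End Converse.

Lemma alternates_critical (T : finType) (p q : T -> nat) m : 1 < m -> #|T| = m.*2 ->
  injective p -> (forall x, p x < m.*2) -> (forall x, q x < m.*2) ->
  alternates m p q -> critical (colour p q).
Proof.
move=> m2 Tm pI pL qL [H|H].
  exact: (alt_critical m2 Tm pI pL).
have [pT N] : critical (colour p (fun x => m.*2.-1 - q x)).
  by apply: (alt_critical m2 Tm pI pL) => x; rewrite H subKn //; have := alt_lt (pL x); lia.
have qL' x : q x <= m.*2.-1 by have := qL x; lia.
by split=> [|x]; rewrite -(prime_colour_opp _ _ qL').
Qed.

(* The four symmetries of the parallel alternation: t = true is the alternation itself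
   and t = false its inverse, complemented if b = true. *)
Definition alternating_word m (t b : bool) (w : seq nat) : Prop :=
  [/\ size w = m.*2, uniq w, {in w, forall x, 0 < x <= m.*2} &
    forall j, j < m.*2 ->
      let v := (nth 0 w j).-1 in
      let: (x, y) := if t then (v, j) else (j, v) in
      y = if b then m.*2.-1 - alt m x else alt m x].

Section AlternatingWord.
Variables (m : nat) (t b : bool) (w : seq nat).
Hypothesis aw : alternating_word m t b w.

Lemma alternating_nth j : j < m.*2 -> 0 < nth 0 w j <= m.*2.
Proof. by case: aw => sw _ wb _ jm; apply: wb; rewrite mem_nth ?sw. Qed.

Lemma alternating_mem : w =i iota 1 m.*2.
Proof.
case: aw => sw uw wb _; have sub : {subset w <= iota 1 m.*2}.
  by move=> x /wb; rewrite mem_iota add1n ltnS.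
by case: (uniq_min_size uw sub); rewrite // size_iota sw.
Qed.

Lemma alternating_rev : alternating_word m t (~~ b) (rev w).
Proof.
case: aw => sw uw wb H; split; rewrite ?size_rev ?rev_uniq //.
  by move=> x; rewrite mem_rev; apply: wb.
move=> j jm; rewrite nth_rev ?sw //; have jm' : m.*2 - j.+1 < m.*2 by lia.
have := H _ jm'; have vm := alternating_nth jm'; move: vm; set v := nth 0 w _ => vm.
have jE : m.*2 - j.+1 = m.*2.-1 - j by lia.
case: (t) (b) => -[] /=; rewrite jE ?alt_opp //.
all: by have := alt_lt jm; have /alt_lt : v.-1 < m.*2 by [lia]; lia.
Qed.

Lemma alternating_complement : alternating_word m t (~~ b) (complement w).
Proof.
case: aw => sw uw wb H; split; rewrite ?size_map ?sw //.
- rewrite map_inj_in_uniq // => x y /wb xw /wb yw; rewrite sw; lia.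
- by move=> x /mapP[y /wb yw ->]; rewrite sw; lia.
move=> j jm; rewrite (nth_map 0) ?sw //.
have := H _ jm; have vm := alternating_nth jm; move: vm; set v := nth 0 w _ => vm.
have -> : (m.*2.+1 - v).-1 = m.*2.-1 - v.-1 by lia.
have v1 : v.-1 < m.*2 by lia.
case: (t) (b) => -[] /=; rewrite ?alt_opp //.
all: by have := alt_lt jm; have := alt_lt v1; lia.
Qed.

Lemma alternating_inverse : alternating_word m (~~ t) b (inverse w).
Proof.
case: aw => sw uw wb H; have wE := alternating_mem; split; rewrite ?size_map ?size_iota ?sw //.
- rewrite map_inj_in_uniq ?iota_uniq // => x y; rewrite sw -!wE => xw yw [E].
  by rewrite -(nth_index 0 xw) E nth_index.
- move=> x /mapP[y]; rewrite sw -wE => yw ->; rewrite /= -sw index_mem //.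
move=> j jm; rewrite (nth_map 0) ?size_iota ?sw // nth_iota // add1n /=.
have jw : j.+1 \in w by rewrite wE mem_iota add1n ltnS.
have im : index j.+1 w < m.*2 by rewrite -sw index_mem.
by have := H _ im; rewrite nth_index //=; case: (t).
Qed.

(** This lets each flag combination be matched with an explicit symmetry of the parallel
    alternation. *)
Lemma alternating_uniq w' : alternating_word m t b w' -> w = w'.
Proof.
move=> aw'; case: (aw) (aw') => sw _ _ H [sw' _ wb' H'].
apply: (@eq_from_nth _ 0); rewrite ?sw ?sw' // => j jm.
have v0 := alternating_nth jm.
have v0' : 0 < nth 0 w' j <= m.*2 by apply: wb'; rewrite mem_nth ?sw'.
suff : (nth 0 w j).-1 = (nth 0 w' j).-1 by lia.
have := H' j jm; have := H j jm; case: (t) => /= [E E'|-> ->] //.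
have v1 : (nth 0 w j).-1 < m.*2 by lia.
have v1' : (nth 0 w' j).-1 < m.*2 by lia.
apply: (alt_inj (m := m)) => //.
by move: E E'; have := alt_lt v1; have := alt_lt v1'; case: (b); lia.
Qed.

End AlternatingWord.

Lemma parallel_alternation_alternating m :
  alternating_word m true false (parallel_alternation m).
Proof.
have nthE j : j < m.*2 ->
    nth 0 (parallel_alternation m) j = if j < m then j.+1.*2 else (j - m).*2.+1.
  move=> jm; rewrite nth_cat size_map size_iota; case: ltnP => mj.
    by rewrite (nth_map 0) ?size_iota // nth_iota.
  have jm' : j - m < m by lia.
  by rewrite (nth_map 0) ?size_iota // nth_iota // add1n doubleS.
have sP : size (parallel_alternation m) = m.*2.
  by rewrite size_cat !size_map size_iota addnn.
have H j : j < m.*2 -> j = alt m (nth 0 (parallel_alternation m) j).-1.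
  move=> jm; rewrite nthE // /alt; case: ltnP => mj.
    by rewrite doubleS /= odd_double uphalf_double.
  by rewrite /= odd_double doubleK; lia.
split=> //.
  apply/(uniqP 0) => i j; rewrite !inE sP => im jm E.
  by rewrite (H i) // (H j) // E.
move=> x /(nthP 0)[j]; rewrite sP => jm <-; rewrite nthE //.
by case: (ltnP j m); lia.
Qed.

Lemma symmetry_alternatingP m w :
  symmetry_of (parallel_alternation m) w <-> exists t b, alternating_word m t b w.
Proof.
have aP := parallel_alternation_alternating m; split=> [|[t [b aw]]].
  elim=> [|u _ [t [b au]]|u _ [t [b au]]|u _ [t [b au]]].
  - by exists true, false.
  - by exists t, (~~ b); apply: alternating_rev.
  - by exists t, (~~ b); apply: alternating_complement.
  - by exists (~~ t), b; apply: alternating_inverse.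
(* The four words are the alternation, its inverse and the reversals of both. *)
have aI := alternating_inverse aP.
case: t b aw => -[] aw.
- by rewrite (alternating_uniq aw (alternating_rev aP)); apply/sym_rev/sym_id.
- by rewrite (alternating_uniq aw aP); apply: sym_id.
- rewrite (alternating_uniq aw (alternating_rev aI)).
  exact/sym_rev/sym_inverse/sym_id.
- by rewrite (alternating_uniq aw aI); apply/sym_inverse/sym_id.
Qed.

Lemma exceptional_critical w :
  exceptional w <-> [/\ 2 <= size w, cayley w & critical (word_colour w)].
Proof.
split=> [[w2 cw sw dw]|[w2 cw [pT N]]]; split=> //; last 2 first.
- exact/simpleP.
- move=> i iw /(@simple_deletionP w (Ordinal iw)); exact/negP.
split; first exact/simpleP.
by move=> k; apply/negP => /simple_deletionP; apply: dw.
Qed.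

Lemma nth_ord_inj (w : seq nat) : uniq w -> injective (fun i : 'I_(size w) => nth 0 w i).
Proof. by move=> uw i j /eqP; rewrite nth_uniq // => /eqP/val_inj. Qed.

(** Letters count from 1 but coordinates from 0; positivity ensures that the predecessor merges no
    two letters. *)
Lemma prime_word_pred w (A : {set 'I_(size w)}) : {in w, forall x, 0 < x} ->
  prime_set (word_colour w) A =
  prime_set (colour (@nat_of_ord (size w)) (fun i => (nth 0 w i).-1)) A.
Proof.
move=> w0; apply: prime_congr => x y z _ _ _; have [->|yz] := eqVneq y z.
  by rewrite !eqxx.
have nz (i : 'I_(size w)) : 0 < nth 0 w i by apply: w0; rewrite mem_nth.
have := nz x; have := nz y; have := nz z; rewrite !colourE // /same_side /=; clear; lia.
Qed.

Lemma alternating_exceptional m t b w : 1 < m -> alternating_word m t b w -> exceptional w.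
Proof.
move=> m2 aw; have wE := alternating_mem aw; case: (aw) => sw uw wb H.
apply/exceptional_critical; split; [by rewrite sw; lia | by exists m.*2; rewrite ?sw |].
have w0 : {in w, forall x, 0 < x} by move=> x /wb/andP[].
pose p := @nat_of_ord (size w); pose q := fun i : 'I_(size w) => (nth 0 w i).-1.
suff [pT N] : critical (colour p q) by split=> [|k]; rewrite prime_word_pred.
have Tm : #|{: 'I_(size w)}| = m.*2 by rewrite card_ord.
have pL x : p x < m.*2 by rewrite -sw; apply: ltn_ord.
have qb (x : 'I_(size w)) : 0 < nth 0 w x <= m.*2 by apply/(alternating_nth aw)/pL.
have qL x : q x < m.*2 by have := qb x; rewrite /q; lia.
have pI : injective p by apply: val_inj.
have qI : injective q.
  move=> x y E; apply: (nth_ord_inj uw).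
  by have := qb x; have := qb y; move: E; rewrite /q /=; lia.
move: H; case: t aw => aw H.
  have [pT N] : critical (colour q p).
    apply: (alternates_critical m2 Tm qI qL pL).
    by case: b aw H => _ H; [right | left] => x; apply: H.
  by split=> [|k]; rewrite prime_colour_swap.
apply: (alternates_critical m2 Tm pI pL qL).
by case: b aw H => _ H; [right | left] => x; apply: H.
Qed.

(** Two occurrences of a letter have a private colour, and [unique_colour_deletion] would then give
    a prime deletion. *)
Lemma critical_uniq w : cayley w -> critical (word_colour w) -> 0 < size w -> uniq w.
Proof.
move=> cw cr w1; apply: contraT => /(uniqPn 0)[i [j [ij jw E]]].
have iw := ltn_trans ij jw; pose a := Ordinal iw; pose b := Ordinal jw.
have ab : a != b by rewrite -val_eqE /= neq_ltn ij.
have cab : word_colour w a b = inl (a, b) by rewrite /word_colour /colour /= E eqxx orbT.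
have [pT N] := cr.
have [||x] := @unique_colour_deletion _ _ (word_colour w) (@colour_rev _ _ _) pT a b ab.
- by move=> x y; rewrite cab /word_colour /colour; case: ifP => // _ [-> ->].
- exact: (critical_card a cr).
- by rewrite (negbTE (N x)).
Qed.

Lemma exceptional_alternating w : exceptional w ->
  exists m t b, 1 < m /\ alternating_word m t b w.
Proof.
move=> /exceptional_critical[w2 cw cr]; have w1 := ltnW w2.
have uw := critical_uniq cw cr w1; have [k kw wE] := cw.
have n4 := critical_card (Ordinal w1) cr; rewrite card_ord in n4.
(* Distinct letters that fill [iota 1 k] make the word a permutation. *)
have kE : size w = k.
  by apply/eqP; rewrite -[k](size_iota 1) -uniq_size_uniq ?iota_uniq //.
have wb : {in w, forall x, 0 < x <= size w} by move=> x; rewrite wE mem_iota add1n ltnS -kE.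
have w0 : {in w, forall x, 0 < x} by move=> x /wb/andP[].
pose p := @nat_of_ord (size w); pose q := fun i : 'I_(size w) => (nth 0 w i).-1.
have qb (x : 'I_(size w)) : 0 < nth 0 w x <= size w by apply: wb; rewrite mem_nth // ltn_ord.
have pL x : p x < #|{: 'I_(size w)}| by rewrite card_ord ltn_ord.
have qL x : q x < #|{: 'I_(size w)}| by rewrite card_ord; have := qb x; rewrite /q; lia.
have pI : injective p by apply: val_inj.
have qI : injective q.
  move=> x y E; apply: (nth_ord_inj uw).
  by have := qb x; have := qb y; move: E; rewrite /q /=; lia.
have cr' : critical (colour p q) by case: cr => pT N; split=> [|x]; rewrite -prime_word_pred.
have [m Tm alts] := critical_permutation (Ordinal w1) pI pL qI qL cr'.
rewrite card_ord in Tm; have m2 : 1 < m by move: n4; rewrite Tm; lia.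
have mk t b : (forall x : 'I_(size w),
      let: (y, z) := if t then (q x, p x) else (p x, q x) in
      z = if b then m.*2.-1 - alt m y else alt m y) ->
    exists m t b, 1 < m /\ alternating_word m t b w.
  move=> H; exists m, t, b; split=> //; split=> //.
    by move=> x /wb; rewrite Tm.
  move=> j jm; have jw : j < size w by rewrite Tm.
  by have := H (Ordinal jw); case: (t).
case: alts => -[] H.
- exact: (mk false false).
- exact: (mk false true).
- exact: (mk true false).
- exact: (mk true true).
Qed.

Theorem theorem5p9 (w : seq nat) :
  exceptional w <->
  exists2 m : nat, 2 <= m & symmetry_of (parallel_alternation m) w.
Proof.
split=> [/exceptional_alternating[m [t [b [m2 aw]]]]|[m m2 /symmetry_alternatingP[t [b aw]]]].
  by exists m => //; apply/symmetry_alternatingP; exists t, b.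
exact: (alternating_exceptional m2 aw).
Qed.
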